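(* The global modal standard Product logic $\vdash_{K\Pi}$ is not axiomatizable.
   Context: The standard Product algebra $[0,1]_{\Pi}$ is the real unit interval with its usual order (lattice operations $\min,\max$), $a\cdot b$ the usual product of reals, $a\rightarrow b=1$ if $a\le b$ and $a\rightarrow b=b/a$ otherwise, constants $0,1$, and $\neg a=a\rightarrow 0$. Modal formulas (set $Fm$) are built from a countable set $\mathcal{V}$ of propositional variables using $\wedge,\vee,\cdot,\rightarrow,\neg,\overline{0},\overline{1}$ and unary $\Box,\Diamond$. A standard Product Kripke model is $\mathfrak{M}=\langle W,R,e\rangle$ with $W\neq\emptyset$, $R\subseteq W\times W$ and $e:W\times\mathcal{V}\to[0,1]$, extended to formulas by interpreting propositional connectives and constants world-wise in $[0,1]_{\Pi}$ and $e(v,\Box\varphi)=\inf_{Rvw}e(w,\varphi)$, $e(v,\Diamond\varphi)=\sup_{Rvw}e(w,\varphi)$ (with $\inf\emptyset=1$, $\sup\emptyset=0$). $K\Pi$ is the class of all these models. $\mathfrak{M}\models\varphi$ means $e(v,\varphi)=1$ for all $v\in W$; similarly for sets. For finite $\Gamma\cup\{\varphi\}\subseteq Fm$, $\Gamma\vdash_{K\Pi}\varphi$ means that every $\mathfrak{M}\in K\Pi$ with $\mathfrak{M}\models\Gamma$ satisfies $\mathfrak{M}\models\varphi$. For arbitrary $\Gamma$, $\Gamma\vdash_{K\Pi}\varphi$ means $\Gamma_0\vdash_{K\Pi}\varphi$ for some finite $\Gamma_0\subseteq\Gamma$. A rule is a pair $\langle\Gamma,\varphi\rangle\in\mathcal{P}(Fm)\times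 Fm$, finitary if $\Gamma$ is finite. A logic is a set of rules that is reflexive ($\langle\Gamma,\gamma\rangle$ for $\gamma\in\Gamma$), closed under cut (if $\langle\Gamma,\phi\rangle$ is in it for all $\phi\in\Phi$ and $\langle\Phi,\varphi\rangle$ is in it, then so is $\langle\Gamma,\varphi\rangle$) and closed under substitutions. A set of rules $R$ axiomatizes a logic if that logic is the smallest logic containing $R$. A logic is axiomatizable if it is axiomatized by some recursive set of finitary rules. *)

(* Defs.v *)
From HB Require Import structures.
From mathcomp Require Import all_boot all_order all_algebra.
From mathcomp Require Import all_classical all_reals.

Set Implicit Arguments.
Unset Strict Implicit.
Unset Printing Implicit Defensive.
Import Order.TTheory GRing.Theory Num.Theory.
Local Open Scope classical_set_scope.
Local Open Scope ring_scope.

Section ProductAlgebra.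
Variable R : realType.
Implicit Types (a b : R) (A : set R).

Definition pimp a b : R := if a <= b then 1 else b / a.
Definition pneg a : R := pimp a 0.

(* Infimum and supremum in the complete lattice [0, 1], for A `<=` [0, 1].
   The library's [inf set0] is 0, hence the case distinction in [inf01]. *)
Definition inf01 A : R := if `[< A !=set0 >] then inf A else 1.
Definition sup01 A : R := if `[< A !=set0 >] then sup A else 0.

End ProductAlgebra.

Inductive form : Type :=
| Var of nat
| And of form & form
| Or of form & form
| Prod of form & form
| Imp of form & form
| Neg of form
| Bot
| Top
| Box of form
| Dia of form.

HB.instance Definition _ := gen_eqMixin form.
HB.instance Definition _ := gen_choiceMixin form.

Fixpoint subst (s : nat -> form) (f : form) : form :=
  match f with
  | Var p => s p
  | And f g => And (subst s f) (subst s g)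
  | Or f g => Or (subst s f) (subst s g)
  | Prod f g => Prod (subst s f) (subst s g)
  | Imp f g => Imp (subst s f) (subst s g)
  | Neg f => Neg (subst s f)
  | Bot => Bot
  | Top => Top
  | Box f => Box (subst s f)
  | Dia f => Dia (subst s f)
  end.

Record kripke_model (R : realType) := KripkeModel {
  world : Type;
  world_inhabited : inhabited world;
  acc : world -> world -> Prop;
  valuation : world -> nat -> R;
  valuation_itv : forall w p, 0 <= valuation w p <= 1
}.

Section Semantics.
Variable R : realType.
Implicit Types (M : kripke_model R) (G : set form) (f : form).

Fixpoint eval M (f : form) (v : world M) : R :=
  match f with
  | Var p => valuation v p
  | And f g => Num.min (eval f v) (eval g v)
  | Or f g => Num.max (eval f v) (eval g v)
  | Prod f g => eval f v * eval g v
  | Imp f g => pimp (eval f v) (eval g v)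
  | Neg f => pneg (eval f v)
  | Bot => 0
  | Top => 1
  | Box f => inf01 [set eval f w | w in acc v]
  | Dia f => sup01 [set eval f w | w in acc v]
  end.

Definition satisfies M f := forall v : world M, eval f v = 1.

Definition entails G f :=
  forall M, (forall g, G g -> satisfies M g) -> satisfies M f.

End Semantics.

Definition rule := (set form * form)%type.

Definition finitary (r : rule) := finite_set r.1.

(* By definition only finitely many premises are used: the semantic consequence
   over arbitrary sets of premises need not be finitary. *)
Definition KPi (R : realType) : set rule :=
  [set r | exists2 G0 : set form,
             finite_set G0 /\ G0 `<=` r.1 & entails R G0 r.2].

Definition is_logic (L : set rule) :=
  [/\ forall G f, G f -> L (G, f),
      forall G D f, (forall g, D g -> L (G, g)) -> L (D, f) -> L (G, f) &
      forall s G f, L (G, f) -> L (subst s @` G, subst s f)].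

Definition axiomatizes (A L : set rule) := L = smallest is_logic A.

(* The total recursive functions of arity k: the least class containing zero,
   successor and the projections, and closed under composition, primitive
   recursion and minimization of regular functions. *)
Inductive recursive : forall k, (k.-tuple nat -> nat) -> Prop :=
| rec_zero k : @recursive k (fun=> 0%N)
| rec_succ : @recursive 1 (fun x => (tnth x ord0).+1)
| rec_proj k (i : 'I_k) : recursive (fun x => tnth x i)
| rec_comp k m (f : m.-tuple nat -> nat) (g : 'I_m -> k.-tuple nat -> nat) :
    recursive f -> (forall i, recursive (g i)) ->
    recursive (fun x => f [tuple g i x | i < m])
| rec_prim k (f : k.-tuple nat -> nat) (g : k.+2.-tuple nat -> nat)
    (h : k.+1.-tuple nat -> nat) :
    recursive f -> recursive g ->
    (forall x : k.-tuple nat, h [tuple of 0%N :: x] = f x) ->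
    (forall n (x : k.-tuple nat),
       h [tuple of n.+1 :: x] = g [tuple of n :: h [tuple of n :: x] :: x]) ->
    recursive h
| rec_min k (f : k.+1.-tuple nat -> nat) (h : k.-tuple nat -> nat) :
    recursive f ->
    (forall x : k.-tuple nat, f [tuple of h x :: x] = 0%N) ->
    (forall (x : k.-tuple nat) n,
       (n < h x)%N -> f [tuple of n :: x] <> 0%N) ->
    recursive h.

(* The boolean [`[< A n >]] is classical: [fun x => `[< A (tnth x ord0) >]] is
   the characteristic function of A, with no computability built in. *)
Definition recursive_set (A : set nat) :=
  @recursive 1 (fun x => nat_of_bool `[< A (tnth x ord0) >]).

(* Goedel numbering; CodeSeq.code is an effective bijection seq nat -> nat. *)
Fixpoint code_form (f : form) : nat :=
  CodeSeq.code match f with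
  | Var p => [:: 0%N; p]
  | And f g => [:: 1%N; code_form f; code_form g]
  | Or f g => [:: 2%N; code_form f; code_form g]
  | Prod f g => [:: 3%N; code_form f; code_form g]
  | Imp f g => [:: 4%N; code_form f; code_form g]
  | Neg f => [:: 5%N; code_form f]
  | Bot => [:: 6%N]
  | Top => [:: 7%N]
  | Box f => [:: 8%N; code_form f]
  | Dia f => [:: 9%N; code_form f]
  end.

(* A finitary rule has one code for each enumeration of its premises. *)
Definition code_rule (G : seq form) (f : form) : nat :=
  CodeSeq.code (code_form f :: map code_form G).

Definition recursive_rules (A : set rule) :=
  recursive_set
    [set n | exists G f, n = code_rule G f /\ A ([set` G], f)].

Definition axiomatizable (L : set rule) :=
  exists A : set rule,
    [/\ A `<=` finitary, recursive_rules A & axiomatizes A L].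

Lemma code_form_inj : injective code_form.
Proof.
have cI s t : CodeSeq.code s = CodeSeq.code t -> s = t.
  exact: (can_inj CodeSeq.codeK).
by elim=> [p|f IHf g IHg|f IHf g IHg|f IHf g IHg|f IHf g IHg|f IHf|||f IHf|f IHf];
  case=> [q|f' g'|f' g'|f' g'|f' g'|f'|||f'|f'] /cI // [];
  first [by move=> -> | by move=> /IHf -> /IHg -> | by move=> /IHf ->].
Qed.

Lemma code_rule_inj G f H g : code_rule G f = code_rule H g -> (G, f) = (H, g).
Proof.
move=> /(can_inj CodeSeq.codeK)[/code_form_inj -> /inj_map ->] //.
exact: code_form_inj.
Qed.

Lemma smallest_logic (A : set rule) : is_logic (smallest is_logic A).
Proof.
split=> [G f Gf L [[+ _ _] _]|G D f GD Df L LA|s G f Gf L LA]; first exact.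
  have [[_ cut _] _] := LA; apply: (cut _ D); last exact: Df.
  by move=> g Dg; exact: GD.
by have [[_ _ sub] _] := LA; apply: sub; exact: Gf.
Qed.

Section Soundness.
Variable R : realType.

Lemma pimp_itv (a b : R) : 0 <= a <= 1 -> 0 <= b <= 1 -> 0 <= pimp a b <= 1.
Proof.
move=> /andP[a0 a1] /andP[b0 b1]; rewrite /pimp; case: (leP a b) => [_|ba].
  by rewrite ler01 lexx.
by rewrite divr_ge0//= ler_pdivrMr ?mul1r ?(ltW ba)// (le_lt_trans b0).
Qed.

Lemma inf01_itv (A : set R) : (forall x, A x -> 0 <= x <= 1) -> 0 <= inf01 A <= 1.
Proof.
move=> A01; rewrite /inf01; case: asboolP => [[x Ax]|_]; last first.
  by rewrite ler01 lexx.
have /andP[_ x1] := A01 _ Ax; rewrite lb_le_inf /=; last 2 first.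
- by exists x.
- by move=> y /A01/andP[].
apply: le_trans x1; apply: ge_inf => //.
by exists 0 => y /A01/andP[].
Qed.

Lemma sup01_itv (A : set R) : (forall x, A x -> 0 <= x <= 1) -> 0 <= sup01 A <= 1.
Proof.
move=> A01; rewrite /sup01; case: asboolP => [[x Ax]|_]; last first.
  by rewrite ler01 lexx.
have /andP[x0 _] := A01 _ Ax; rewrite ge_sup /= ?andbT; last 2 first.
- by exists x.
- by move=> y /A01/andP[].
apply: (le_trans x0); apply: ub_le_sup => //.
by exists 1 => y /A01/andP[].
Qed.

Lemma eval_itv (M : kripke_model R) f (v : world M) : 0 <= eval f v <= 1.
Proof.
elim: f v => [p|f IHf g IHg|f IHf g IHg|f IHf g IHg|f IHf g IHg|f IHf|||f IHf|f IHf]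
  v /=.
- exact: valuation_itv.
- by rewrite /Num.min; case: ifP.
- by rewrite /Num.max; case: ifP.
- have /andP[? ?] := IHf v; have /andP[? ?] := IHg v.
  by rewrite mulr_ge0//= mulr_ile1.
- exact: pimp_itv.
- by apply: pimp_itv => //; rewrite lexx ler01.
- by rewrite lexx ler01.
- by rewrite ler01 lexx.
- by apply: inf01_itv => _ [w _ <-].
- by apply: sup01_itv => _ [w _ <-].
Qed.

Definition subst_model (s : nat -> form) (M : kripke_model R) :=
  @KripkeModel R (world M) (world_inhabited M) (@acc _ M)
    (fun w p => eval (s p) w) (fun w p => eval_itv (s p) w).

Lemma eval_subst s M f (v : world M) :
  eval (subst s f) v = eval (M := subst_model s M) f v.
Proof.
elim: f v => [p|f IHf g IHg|f IHf g IHg|f IHf g IHg|f IHf g IHg|f IHf|||f IHf|f IHf]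
  v //=; rewrite ?IHf ?IHg //; congr (_ _).
- by apply: eq_imagel => w _; exact: IHf.
- by apply: eq_imagel => w _; exact: IHf.
Qed.

Lemma KPi_logic : is_logic (KPi R).
Proof.
split=> [G f Gf|G D f GD [D0 [finD0 D0D] D0f]|s G f [G0 [finG0 G0G] G0f]].
- by exists [set f] => [|M]; [split=> [|_ ->//] | exact].
- have /choice[F FP] : forall g, exists F : set form, D0 g ->
      [/\ finite_set F, F `<=` G & entails R F g].
    move=> g; case: (pselect (D0 g)) => [/D0D/GD[F [? ?] ?]|]; last by exists set0.
    by exists F.
  exists (\bigcup_(g in D0) F g); first split.
  + by apply: bigcup_finite => // g /FP[].
  + by move=> h [g /FP[_ FG _]]; exact: FG.
  + move=> M MF; apply: D0f => g D0g; have [_ _] := FP _ D0g; apply=> h Fh.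
    by apply: MF; exists g.
- exists (subst s @` G0).
    by split; [exact: finite_image | exact: image_subset].
  move=> M MG v; rewrite eval_subst; apply: G0f => g G0g w.
  by rewrite -eval_subst; apply: MG; exists g.
Qed.

End Soundness.

(* Main.v *)
From HB Require Import structures.
From mathcomp Require Import all_boot all_order all_algebra.
From mathcomp Require Import all_classical all_reals.
From mathcomp Require Import zify ring.
Require Import Defs.

Set Implicit Arguments.
Unset Strict Implicit.
Unset Printing Implicit Defensive.
Import Order.TTheory GRing.Theory Num.Theory.

(** Provability in Horn programs over the natural numbers reduces to
    non-consequence: a program [P] and a goal [p(c)] give a rule that is valid iff
    [P] does not derive [p(c)].  A world of a countermodel is a node of a proof
    tree.  A natural number [n] is stored as the value [y^n], where [0 < y < 1] is
    the value of a fixed variable, so that terms become products and equations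
    between them are expressible.  A second variable [t] satisfies
    [t <= y * Box t], hence is multiplied by at least [1/y] along every edge;
    since it is positive and at most [1], the archimedean property bounds the
    depth below the refuting world, so that the tree read off there is
    well-founded.

    If a recursive set [A] of finitary rules axiomatized the logic, then
    derivability from [A] would be Horn-definable, because recursive functions
    have Horn-definable graphs.  Let [P] derive [p(c)] iff the rule with code [c],
    extended by the premise "[x = y^c]", is derivable from [A].  For [c] the code
    of the rule associated with [P] and [p] itself, this extended rule is
    derivable iff [P] derives [p(c)], and valid iff it does not. *)

(** * Horn programs *)

Inductive term := TV of nat | TN of nat | TS of term | TD of term & term.

(** A fixed arity lets a world store its atom in four variables; predicates with fewer arguments are
    padded with zeros. *)
Record atom := Atom { lab : nat; arg1 : term; arg2 : term; arg3 : term }.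

Record clause := Clause { head : atom; body : seq atom }.

HB.instance Definition _ := gen_eqMixin clause.
HB.instance Definition _ := gen_eqMixin atom.

Fixpoint tval (s : nat -> nat) t :=
  match t with
  | TV i => s i
  | TN k => k
  | TS t => (tval s t).+1
  | TD t u => tval s t + tval s u
  end.

Definition interp := nat -> nat -> nat -> nat -> Prop.

Definition holds (I : interp) s a :=
  I (lab a) (tval s (arg1 a)) (tval s (arg2 a)) (tval s (arg3 a)).

Fixpoint holds_all I s bs :=
  if bs is b :: bs' then holds I s b /\ holds_all I s bs' else True.

Lemma holds_allP I s bs : holds_all I s bs <-> forall b, b \in bs -> holds I s b.
Proof.
elim: bs => [|b bs IH] /=; first by split.
split=> [[Hb /IH Hbs] b'|H].
  by rewrite inE => /orP[/eqP-> //|/Hbs].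
split; first by apply: H; rewrite inE eqxx.
by apply/IH => b' b's; apply: H; rewrite inE b's orbT.
Qed.

Section Derivations.
Variable P : seq clause.

(** The height bound stays explicit because it becomes the rank of a node in the countermodel built
    from a derivation. *)
Fixpoint der n : interp :=
  if n is n'.+1 then fun l a b c =>
    exists C s, [/\ C \in P, holds_all (der n') s (body C) &
      (lab (head C), tval s (arg1 (head C)), tval s (arg2 (head C)),
       tval s (arg3 (head C))) = (l, a, b, c)]
  else fun _ _ _ _ => False.

Definition proves : interp := fun l a b c => exists n, der n l a b c.

Definition sound (I : interp) :=
  forall C s, C \in P -> holds_all I s (body C) -> holds I s (head C).

Lemma derS n l a b c : der n l a b c -> der n.+1 l a b c.
Proof.
elim: n l a b c => [|n IH] l a b c //= [C [s [CP bC eqC]]].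
exists C, s; split => //; apply/holds_allP => d dC.
by apply: IH; move/holds_allP: bC; exact.
Qed.

Lemma der_le n m l a b c : n <= m -> der n l a b c -> der m l a b c.
Proof. by move=> /subnK <-; elim: (m - n) => // k IH /IH; exact: derS. Qed.

Lemma der_bound s bs :
  holds_all proves s bs -> exists n, holds_all (der n) s bs.
Proof.
elim: bs => [|b bs IH] /=; first by exists 0.
move=> [[n Hn] /IH[m Hm]]; exists (maxn n m); split.
  by apply: der_le Hn; exact: leq_maxl.
apply/holds_allP => d dbs; apply: (@der_le m); first exact: leq_maxr.
by move/holds_allP: Hm; exact.
Qed.

Lemma proves_clause C s :
  C \in P -> holds_all proves s (body C) -> holds proves s (head C).
Proof. by move=> CP /der_bound[n Hn]; exists n.+1, C, s. Qed.

(** Induction over derivations in the form used throughout: an interpretation closed under the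
    clauses bounds from above what they prove. *)
Lemma proves_sound I l a b c : sound I -> proves l a b c -> I l a b c.
Proof.
move=> SI [n]; elim: n l a b c => [|n IH] l a b c //= [C [s [CP bC [<- <- <- <-]]]].
apply: SI => //; apply/holds_allP => d dC; apply: IH.
by move/holds_allP: bC; exact.
Qed.

End Derivations.

Lemma sound_cons C P I :
  (forall s, holds_all I s (body C) -> holds I s (head C)) -> sound P I ->
  sound (C :: P) I.
Proof. by move=> IC IP D s; rewrite inE => /orP[/eqP-> /IC|/IP]; auto. Qed.

Lemma sound_cat P Q I : sound P I -> sound Q I -> sound (P ++ Q) I.
Proof. by move=> IP IQ C s; rewrite mem_cat => /orP[/IP|/IQ]; apply. Qed.

Lemma proves_subset P Q l a b c :
  {subset P <= Q} -> proves P l a b c -> proves Q l a b c.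
Proof.
move=> PQ; apply: (@proves_sound P (proves Q)) => C s CP.
by apply: proves_clause; exact: PQ.
Qed.

(** * Conservative extensions of programs by clauses for fresh predicates *)

Definition labels C := lab (head C) :: map lab (body C).

Definition labelled n (P : seq clause) := all (fun C => all (gtn n) (labels C)) P.

Definition bare i t := if t is TV j then j == i else false.

Fixpoint tvars t :=
  match t with
  | TV i => [:: i]
  | TN _ => [::]
  | TS t => tvars t
  | TD t u => tvars t ++ tvars u
  end.

Definition avars a := tvars (arg1 a) ++ tvars (arg2 a) ++ tvars (arg3 a).

Definition binds i a := [|| bare i (arg1 a), bare i (arg2 a) | bare i (arg3 a)].

(* In a model the clause variables take arbitrary values in [0, 1]; occurring as
   an argument of a derived premise forces them to be powers of [y]. *)
Definition safe C :=
  all (fun i => has (binds i) (body C)) (flatten (map avars (head C :: body C))).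

(** Old predicates mean what [P] proves, so soundness of added clauses is checked with a [J] chosen
    for the new predicates alone. *)
Definition ext_interp P n (J : interp) : interp := fun l a b c =>
  if l < n then proves P l a b c else J (l - n) a b c.

Section Extension.
Variables (P : seq clause) (n : nat).
Hypothesis wfP : labelled n P.

Lemma ext_old J l : l < n -> ext_interp P n J l = proves P l.
Proof.
by move=> ln; apply/funext => a; apply/funext => b; apply/funext => c;
  rewrite /ext_interp ln.
Qed.

Lemma ext_new J k : ext_interp P n J (n + k) = J k.
Proof.
apply/funext => a; apply/funext => b; apply/funext => c.
by rewrite /ext_interp ltnNge leq_addr /= addKn.
Qed.

Lemma ext_sound Q J l a b c :
  sound Q (ext_interp P n J) -> proves (P ++ Q) l a b c -> ext_interp P n J l a b c.
Proof.
move=> SQ; apply: proves_sound; apply: sound_cat => // C s CP bC.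
move/allP/(_ _ CP): (wfP) => /andP[hC /allP lC].
rewrite /holds ext_old //; apply: proves_clause => //.
apply/holds_allP => d dC; move/holds_allP: bC => /(_ _ dC).
by rewrite /holds ext_old //; apply: lC; apply: map_f.
Qed.

(** With the new predicates interpreted as always true, clauses with new heads are sound, while the
    old predicates still mean provability in [P]. *)
Lemma proves_cat Q l : all (fun C => n <= lab (head C)) Q -> l < n ->
  proves (P ++ Q) l = proves P l.
Proof.
move=> hQ ln; apply/funext => a; apply/funext => b; apply/funext => c.
apply/propext; split; last by apply: proves_subset => C; rewrite mem_cat => ->.
move=> H; rewrite -(ext_old (fun _ _ _ _ => True) ln).
apply: ext_sound H => C s CQ _; rewrite /holds /ext_interp ltnNge.
by move/allP/(_ _ CQ): hQ => ->.
Qed.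

End Extension.

Definition extends n P n' P' :=
  [/\ n <= n', labelled n' P', all safe P' &
      forall l, l < n -> proves P' l = proves P l].

Lemma labelledW n n' P : n <= n' -> labelled n P -> labelled n' P.
Proof.
move=> le; apply: sub_all => C; apply: sub_all => l /= ln.
exact: leq_trans ln le.
Qed.

Lemma extends_trans n P n' P' n'' P'' :
  extends n P n' P' -> extends n' P' n'' P'' -> extends n P n'' P''.
Proof.
move=> [le1 _ _ E1] [le2 w2 s2 E2]; split => //; first exact: leq_trans le2.
by move=> l ln; rewrite E2 ?E1 //; exact: leq_trans le1.
Qed.

Lemma extends_refl n P : labelled n P -> all safe P -> extends n P n P.
Proof. by move=> w s; split. Qed.

Lemma extends_cat n P k Q : labelled n P -> all safe P ->
  labelled (n + k) Q -> all safe Q -> all (fun C => n <= lab (head C)) Q ->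
  extends n P (n + k) (P ++ Q).
Proof.
move=> wP sP wQ sQ hQ; split; first exact: leq_addr.
- by rewrite /labelled all_cat; apply/andP; split => //; exact: labelledW (leq_addr _ _) wP.
- by rewrite all_cat sP sQ.
- by move=> l ln; exact: (proves_cat wP).
Qed.

(** * Encoding programs as modal formulas *)

(* The rank [vT] bounds the height of a proof tree, [vX] holds the input and [vG]
   marks the goal.  The remaining variables store the current atom, [zvar i] the
   clause variables; [kvar j] holds at the proof of the j-th premise. *)
Definition vY := 0.
Definition vT := 1.
Definition vX := 2.
Definition vG := 3.
Definition vL := 4.
Definition vA := 5.
Definition vB := 6.
Definition vC := 7.
Definition zvar i := i.*2.+4.+4.
Definition kvar i := i.*2.+1.+4.+4.

Fixpoint tform t :=
  match t with
  | TV i => Var (zvar i)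
  | TN k => iter k (Prod (Var vY)) Top
  | TS t => Prod (Var vY) (tform t)
  | TD t u => Prod (tform t) (tform u)
  end.

Definition numeral k := tform (TN k).

Definition Iff f g := And (Imp f g) (Imp g f).
Definition conjs := foldr And Top.
Definition disjs := foldr Or Bot.

(** The entry for [vY] passes the same base [y] to the proofs of the premises; where [y] is
    positive, it also forces these successors to exist. *)
Definition fields a :=
  [:: (vY, Var vY); (vL, numeral (lab a)); (vA, tform (arg1 a));
      (vB, tform (arg2 a)); (vC, tform (arg3 a))].

Definition head_form a := conjs [seq Iff (Var p.1) p.2 | p <- fields a].

(* The double negation makes the formula two-valued. *)
Definition child j := Neg (Neg (Var (kvar j))).

(* Equality of the infimum and the supremum gives a unique value at the successors
   of index j; as inf over the empty set is 1 and sup is 0, one such successor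
   exists. *)
Definition child_form j a :=
  conjs [seq And (Iff (Box (Imp (child j) (Var p.1))) p.2)
                 (Iff (Dia (And (child j) (Var p.1))) p.2) | p <- fields a].

Definition atom0 := Atom 0 (TN 0) (TN 0) (TN 0).

Definition clause_form C :=
  And (head_form (head C))
      (conjs [seq child_form j (nth atom0 (body C) j) | j <- iota 0 (size (body C))]).

(** [Top] is [y ^+ 0], so the last conjunct sets the second and third arguments of the goal atom to
    zero. Its double negation makes it binding wherever [vG] is positive. *)
Definition program_form P p :=
  conjs [:: disjs (map clause_form P);
            Imp (Var vT) (Prod (Var vY) (Box (Var vT)));
            Imp (Neg (Neg (Var vG)))
              (conjs [:: Iff (Var vL) (numeral p); Iff (Var vA) (Var vX);
                         Iff (Var vB) Top; Iff (Var vC) Top])].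

Definition input_form c := Iff (Var vX) (numeral c).

(** As the disjuncts are [y] and three two-valued negations, the value differs from 1 exactly when
    [0 < y < 1] and both [vT] and [vG] are positive. *)
Definition goal_form :=
  Or (Or (Var vY) (Neg (Var vY))) (Or (Neg (Var vT)) (Neg (Var vG))).

Section Semantics.
Local Open Scope classical_set_scope.
Local Open Scope ring_scope.

(** * Truth conditions of formulas and of the premise encoding *)

Section Eval.
Variable R : realType.

Lemma inf01_le (A : set R) x : (forall z, A z -> 0 <= z <= 1) -> A x -> inf01 A <= x.
Proof.
move=> A01 Ax; rewrite /inf01; case: asboolP => [_|[]]; last by exists x.
by apply: ge_inf => //; exists 0 => z /A01/andP[].
Qed.

Lemma le_inf01 (A : set R) u : u <= 1 -> (forall z, A z -> u <= z) -> u <= inf01 A.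
Proof.
by move=> u1 uA; rewrite /inf01; case: asboolP => // A0; apply: lb_le_inf.
Qed.

Lemma le_sup01 (A : set R) x : (forall z, A z -> 0 <= z <= 1) -> A x -> x <= sup01 A.
Proof.
move=> A01 Ax; rewrite /sup01; case: asboolP => [_|[]]; last by exists x.
by apply: ub_le_sup => //; exists 1 => z /A01/andP[].
Qed.

Lemma sup01_le (A : set R) u : 0 <= u -> (forall z, A z -> z <= u) -> sup01 A <= u.
Proof.
by move=> u1 uA; rewrite /sup01; case: asboolP => // A0; apply: ge_sup.
Qed.

Variable M : kripke_model R.
Implicit Types (f g : form) (w : world M).

Lemma eval_ge0 f w : 0 <= eval f w.
Proof. by have /andP[] := eval_itv f w. Qed.

Lemma eval_le1 f w : eval f w <= 1.
Proof. by have /andP[] := eval_itv f w. Qed.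

Lemma eval_Imp1 f g w : eval (Imp f g) w = 1 <-> eval f w <= eval g w.
Proof.
rewrite /= /pimp; case: leP => // lt; split=> // H.
by move: lt; rewrite (divr1_eq H) ltxx.
Qed.

Lemma eval_And1 f g w : eval (And f g) w = 1 <-> eval f w = 1 /\ eval g w = 1.
Proof.
split=> /= [H|[-> ->]]; last by rewrite minxx.
have : 1 <= Num.min (eval f w) (eval g w) by rewrite H.
rewrite le_min => /andP[f1 g1].
by split; apply/eqP; rewrite eq_le eval_le1.
Qed.

Lemma eval_Or1 f g w : eval (Or f g) w = 1 <-> eval f w = 1 \/ eval g w = 1.
Proof.
split=> [|[]H]; last 2 first.
- by apply/eqP; rewrite eq_le eval_le1 /= le_max H lexx.
- by apply/eqP; rewrite eq_le eval_le1 /= le_max H lexx orbT.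
by rewrite /= /Num.max; case: ifP => _ H; [right|left].
Qed.

Lemma eval_Iff1 f g w : eval (Iff f g) w = 1 <-> eval f w = eval g w.
Proof.
rewrite eval_And1 !eval_Imp1; split=> [[fg gf]|->]; last by rewrite lexx.
by apply/eqP; rewrite eq_le fg gf.
Qed.

Lemma eval_conj1 fs w : eval (conjs fs) w = 1 <-> {in fs, forall f, eval f w = 1}.
Proof.
elim: fs => [|f fs IH]; first by split.
split=> [/eval_And1[f1 /IH fs1] g|H].
  by rewrite inE => /orP[/eqP->|/fs1].
apply/eval_And1; split; first by apply: H; rewrite inE eqxx.
by apply/IH => g gfs; apply: H; rewrite inE gfs orbT.
Qed.

Lemma eval_disj1 fs w : eval (disjs fs) w = 1 <-> exists2 f, f \in fs & eval f w = 1.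
Proof.
elim: fs => [|f fs IH] /=.
  by split=> [/eqP|[]//]; rewrite eq_sym oner_eq0.
split=> [/eval_Or1[f1|/IH[g gfs g1]]|[g]].
- by exists f => //; rewrite inE eqxx.
- by exists g => //; rewrite inE gfs orbT.
rewrite inE => /orP[/eqP->|gfs] g1; apply/eval_Or1; first by left.
by right; apply/IH; exists g.
Qed.

Lemma eval_Neg f w : eval (Neg f) w = (eval f w == 0)%:R.
Proof.
rewrite /= /pneg /pimp eq_le eval_ge0 andbT mul0r.
by case: ifP.
Qed.

Lemma eval_NegNeg f w : eval (Neg (Neg f)) w = (eval f w != 0)%:R.
Proof. by rewrite !eval_Neg pnatr_eq0; case: (eval f w == 0). Qed.

Lemma eval_TN k w : eval (numeral k) w = eval (Var vY) w ^+ k.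
Proof. by elim: k => [|k IH] //=; rewrite exprS -IH. Qed.

Lemma eval_tform s t w :
  (forall i, i \in tvars t -> eval (Var (zvar i)) w = eval (Var vY) w ^+ s i) ->
  eval (tform t) w = eval (Var vY) w ^+ tval s t.
Proof.
elim: t => [i|k|t IH|t IHt u IHu] H.
- by apply: H; rewrite inE.
- exact: eval_TN.
- by rewrite /= IH // exprS.
- rewrite /= IHt ?IHu ?exprD // => i iv; apply: H; rewrite /= mem_cat iv ?orbT//.
Qed.

Lemma exprn_inj01 (y : R) m n : 0 < y < 1 -> y ^+ m = y ^+ n -> m = n.
Proof.
case/andP=> y0 y1 E; apply/eqP; rewrite eqn_leq.
by rewrite -!(ler_iXn2l y0 y1) E lexx.
Qed.

Definition child_at j (w w' : world M) := acc w w' /\ eval (child j) w' = 1.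

Lemma child_fields j a w : 0 < eval (Var vY) w -> eval (child_form j a) w = 1 ->
  exists2 w', child_at j w w' &
    forall p, p \in fields a -> eval (Var p.1) w' = eval p.2 w.
Proof.
move=> y0 /eval_conj1 H.
have {}H p : p \in fields a ->
    eval (Box (Imp (child j) (Var p.1))) w = eval p.2 w /\
    eval (Dia (And (child j) (Var p.1))) w = eval p.2 w.
  move=> pa; have /eval_And1[/eval_Iff1 H1 /eval_Iff1 H2] := H _ (map_f _ pa).
  by [].
(* Otherwise the two-valued [child j] is 0 at all successors, and the supremum in the entry for
   [vY], which equals [y > 0], is 0. *)
have [w' ww' k1] : exists2 w', acc w w' & eval (child j) w' = 1.
  have /H[_ E] : (vY, Var vY) \in fields a by rewrite inE eqxx.
  apply: contrapT => nex; move: y0; rewrite -E ltNge => /negP; apply.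
  apply: sup01_le => // z [w' ww' <-]; rewrite ge_min; apply/orP; left.
  have E1 : eval (child j) w' = (eval (Var (kvar j)) w' != 0)%:R.
    exact: eval_NegNeg.
  change (eval (child j) w' <= 0).
  move: E1; case: eqP => [_ ->|_ E1] //.
  by case: nex; exists w'.
exists w' => // p /H[E1 E2].
apply/eqP; rewrite eq_le; apply/andP; split.
  rewrite -E2; apply: le_sup01.
    by move=> _ [v _ <-]; exact: (eval_itv (And (child j) (Var p.1))).
  exists w' => //; change (Num.min (eval (child j) w') (eval (Var p.1) w') = eval (Var p.1) w').
  by rewrite k1; apply/min_idPr; exact: eval_le1.
rewrite -E1; apply: inf01_le.
  by move=> _ [v _ <-]; exact: (eval_itv (Imp (child j) (Var p.1))).
exists w' => //.
change (pimp (eval (child j) w') (eval (Var p.1) w') = eval (Var p.1) w').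
rewrite k1 /pimp divr1; case: ifP => // H1; apply/eqP; rewrite eq_le H1.
by rewrite eval_le1.
Qed.

End Eval.

Lemma exists_expr_lt (R : realType) (y t : R) : 0 < y < 1 -> 0 < t ->
  exists n, y ^+ n < t.
Proof.
case/andP=> y0 y1 t0; have d0 : 0 < 1 - y by rewrite subr_gt0.
(* A Bernoulli-type bound. The induction step rests on a difference of
   [n.+1%:R * (1 - y) ^+ 2 >= 0]; any [n] above the inverse of [t * (1 - y)] then gives the
   claim. *)
have H n : y ^+ n * (1 + n%:R * (1 - y)) <= 1.
  elim: n => [|n IH]; first by rewrite mul0r addr0 mulr1.
  apply: le_trans IH; rewrite exprSr -mulrA ler_wpM2l ?exprn_ge0 ?(ltW y0) //.
  rewrite -subr_ge0; have -> : 1 + n%:R * (1 - y) - y * (1 + n.+1%:R * (1 - y)) =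
      n.+1%:R * (1 - y) ^+ 2 by rewrite -natr1; ring.
  by rewrite mulr_ge0 ?ler0n ?sqr_ge0.
exists (Num.bound (t * (1 - y))^-1); set n := Num.bound _.
have nb : 1 < t * (n%:R * (1 - y)).
  rewrite mulrCA -ltr_pdivrMr ?mulr_gt0 // mul1r.
  by apply: archi_boundP; rewrite invr_ge0 mulr_ge0 ?ltW.
rewrite ltNge; apply/negP => tn.
suff : t * (n%:R * (1 - y)) <= 1 by rewrite leNgt nb.
apply: le_trans (H n); apply: ler_pM => //; [exact: ltW|by rewrite mulr_ge0 ?ler0n ?ltW|].
by rewrite lerDr.
Qed.

(** * Derivations read off countermodels *)

Section ModelToProof.
Variables (R : realType) (M : kripke_model R) (P : seq clause) (p : nat).
Hypothesis safeP : all safe P.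
Hypothesis MP : satisfies M (program_form P p).

Definition encodes (w : world M) (l a b d : nat) :=
  let y := eval (Var vY) w in
  [/\ eval (Var vL) w = y ^+ l, eval (Var vA) w = y ^+ a,
      eval (Var vB) w = y ^+ b & eval (Var vC) w = y ^+ d].

Lemma model_clause (w : world M) : exists2 C, C \in P & eval (clause_form C) w = 1.
Proof.
have /eval_And1[/eval_disj1[_ /mapP[C CP ->] C1] _] := MP w.
by exists C.
Qed.

Lemma model_rank (w w' : world M) : acc w w' ->
  eval (Var vT) w <= eval (Var vY) w * eval (Var vT) w'.
Proof.
move=> ww'; have /eval_And1[_ /eval_And1[/eval_Imp1 + _]] := MP w.
move=> /le_trans; apply; apply: ler_wpM2l; first exact: (eval_ge0 (Var vY)).
apply: inf01_le; last by exists w'.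
by move=> _ [v _ <-]; exact: (eval_itv (Var vT)).
Qed.

Lemma model_goal (w : world M) : 0 < eval (Var vG) w ->
  [/\ eval (Var vL) w = eval (Var vY) w ^+ p, eval (Var vA) w = eval (Var vX) w,
      eval (Var vB) w = 1 & eval (Var vC) w = 1].
Proof.
move=> G0; have /eval_And1[_ /eval_And1[_ /eval_And1[/eval_Imp1 + _]]] := MP w.
set g := conjs _.
rewrite eval_NegNeg (gt_eqF G0) => g1.
have {g1} : eval g w = 1 by apply/eqP; rewrite eq_le eval_le1.
move=> /eval_And1[/eval_Iff1 E1 /eval_And1[/eval_Iff1 E2 /eval_And1[/eval_Iff1 E3]]].
by move=> /eval_And1[/eval_Iff1 E4 _]; rewrite E1 eval_TN.
Qed.

(** Induction on a bound for the depth below [w]: [y ^+ n < t] contradicts [t <= 1] when [n = 0],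
    and each edge divides [t] by at least [y], which lowers [n] by one. *)
Lemma model_proves n (w : world M) : 0 < eval (Var vY) w < 1 ->
  eval (Var vY) w ^+ n < eval (Var vT) w ->
  exists l a b d, proves P l a b d /\ encodes w l a b d.
Proof.
elim: n w => [|n IH] w /[dup] y01 /andP[y0 y1] yt.
  by move: yt; rewrite expr0 ltNge eval_le1.
have [C CP /eval_And1[/eval_conj1 hC /eval_conj1 bC]] := model_clause w.
set y := eval (Var vY) w in y01 y0 y1 yt.
have {}bC b : b \in body C -> exists l a1 a2 a3, proves P l a1 a2 a3 /\
    [/\ y ^+ lab b = y ^+ l, eval (tform (arg1 b)) w = y ^+ a1,
        eval (tform (arg2 b)) w = y ^+ a2 & eval (tform (arg3 b)) w = y ^+ a3].
  move=> bb; have /bC : child_form (index b (body C)) b \in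
      [seq child_form j (nth atom0 (body C) j) | j <- iota 0 (size (body C))].
    apply/mapP; exists (index b (body C)); last by rewrite nth_index.
    by rewrite mem_iota index_mem.
  move=> /(child_fields y0)[w' [ww' _] F].
  have Fy : eval (Var vY) w' = y by apply: (F (vY, Var vY)); rewrite inE eqxx.
  have [] := IH w'; rewrite ?Fy //.
    have := lt_le_trans yt (model_rank ww').
    by rewrite -/y exprS ltr_pM2l.
  move=> l [a1 [a2 [a3 [Pb []]]]]; rewrite Fy => E1 E2 E3 E4.
  exists l, a1, a2, a3; split=> //.
  rewrite -E1 -E2 -E3 -E4 -eval_TN; split; symmetry.
  - by apply: (F (vL, numeral (lab b))); rewrite !inE ?eqxx ?orbT.
  - by apply: (F (vA, tform (arg1 b))); rewrite !inE ?eqxx ?orbT.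
  - by apply: (F (vB, tform (arg2 b))); rewrite !inE ?eqxx ?orbT.
  - by apply: (F (vC, tform (arg3 b))); rewrite !inE ?eqxx ?orbT.
pose vs := flatten (map avars (head C :: body C)).
(* Safety supplies the assignment: each variable of the clause is itself an argument of some
   premise, and the child proving that premise stores a power of [y] there. *)
have /choice[s Hs] : forall i, exists n, i \in vs -> eval (Var (zvar i)) w = y ^+ n.
  move=> i; case: (boolP (i \in vs)) => [ivs|_]; last by exists 0%N.
  move/allP/(_ _ CP)/allP/(_ _ ivs)/hasP: safeP => [b bb bi].
  have [l [a1 [a2 [a3 [_ [_ E1 E2 E3]]]]]] := bC b bb.
  have bareE t : bare i t -> t = TV i by case: t => //= j /eqP->.
  case/or3P: bi => /bareE E; [move: E1|move: E2|move: E3]; rewrite E => E'.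
  - by exists a1.
  - by exists a2.
  - by exists a3.
have E b : b \in head C :: body C -> [/\ eval (tform (arg1 b)) w = y ^+ tval s (arg1 b),
    eval (tform (arg2 b)) w = y ^+ tval s (arg2 b) &
    eval (tform (arg3 b)) w = y ^+ tval s (arg3 b)].
  move=> bb; split; apply: eval_tform => i ib; apply: Hs; apply/flattenP;
    by exists (avars b); rewrite ?map_f // !mem_cat ib ?orbT.
(* Since [y ^+ n] determines [n], the atoms found at the children are the instances of the premises
   under [s]. *)
have PC : holds (proves P) s (head C).
  apply: proves_clause => //; apply/holds_allP => b bb.
  have [l [a1 [a2 [a3 [Pb [E0 E1 E2 E3]]]]]] := bC b bb.
  have [] := E b; first by rewrite inE bb orbT.
  rewrite E1 E2 E3 /holds.
  by do 3!move/(exprn_inj01 y01) <-; rewrite (exprn_inj01 y01 E0).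
exists (lab (head C)), (tval s (arg1 (head C))), (tval s (arg2 (head C))),
  (tval s (arg3 (head C))); split=> //.
have [|E1 E2 E3] := E (head C); first by rewrite inE eqxx.
have {}hC q : q \in fields (head C) -> eval (Var q.1) w = eval q.2 w.
  by move=> qC; apply/eval_Iff1; apply: hC; apply/mapP; exists q.
rewrite /encodes -/y -E1 -E2 -E3 -eval_TN; split.
- by apply: (hC (vL, numeral (lab (head C)))); rewrite !inE ?eqxx ?orbT.
- by apply: (hC (vA, tform (arg1 (head C)))); rewrite !inE ?eqxx ?orbT.
- by apply: (hC (vB, tform (arg2 (head C)))); rewrite !inE ?eqxx ?orbT.
- by apply: (hC (vC, tform (arg3 (head C)))); rewrite !inE ?eqxx ?orbT.
Qed.

Lemma model_goal_proves c (w : world M) : satisfies M (input_form c) ->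
  eval goal_form w <> 1 -> proves P p c 0 0.
Proof.
move=> Mc phi1.
have Vle0 v : ~ eval (Neg (Var v)) w = 1 -> 0 < eval (Var v) w.
  by rewrite eval_Neg lt_neqAle eq_sym eval_ge0; case: eqP.
have y1 : eval (Var vY) w < 1.
  rewrite lt_neqAle eval_le1 andbT; apply/eqP => y1; apply: phi1.
  by apply/eval_Or1; left; apply/eval_Or1; left.
have y0 : 0 < eval (Var vY) w.
  by apply: Vle0 => y1'; apply: phi1; apply/eval_Or1; left; apply/eval_Or1; right.
have t0 : 0 < eval (Var vT) w.
  by apply: Vle0 => y1'; apply: phi1; apply/eval_Or1; right; apply/eval_Or1; left.
have G0 : 0 < eval (Var vG) w.
  by apply: Vle0 => y1'; apply: phi1; apply/eval_Or1; right; apply/eval_Or1; right.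
have y01 : 0 < eval (Var vY) w < 1 by rewrite y0.
have [n yt] := exists_expr_lt y01 t0.
have [l [a [b [d [Pw [E1 E2 E3 E4]]]]]] := model_proves y01 yt.
have [F1 F2 F3 F4] := model_goal G0.
have /eval_Iff1 F5 := Mc w; rewrite eval_TN in F5.
have := Pw; rewrite (exprn_inj01 y01 (etrans (esym E1) F1)).
rewrite (exprn_inj01 y01 (etrans (esym E2) (etrans F2 F5))).
rewrite (exprn_inj01 (n := 0) y01 (etrans (esym E3) F3)).
by rewrite (exprn_inj01 (n := 0) y01 (etrans (esym E4) F4)).
Qed.

End ModelToProof.

(** * Countermodels built from derivations *)

Section ProofToModel.
Variables (R : realType) (P : seq clause) (p c : nat).

(** The worlds are all clause instances with derivable bodies, not the nodes of one chosen tree. The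
    index tells which premise of a parent the node proves. *)
Record node := Node {
  node_index : nat;
  node_clause : clause;
  node_env : nat -> nat;
  node_rank : nat;
  node_clauseP : node_clause \in P;
  node_der : holds_all (der P node_rank) node_env (body node_clause)
}.

Definition inst s a := (lab a, tval s (arg1 a), tval s (arg2 a), tval s (arg3 a)).

Definition node_atom w := inst (node_env w) (head (node_clause w)).

(** Different derivations of one premise give several successors with the same index; they share
    their atom, which is enough for the infimum and the supremum to agree. *)
Definition node_acc w w' :=
  [/\ (node_index w' < size (body (node_clause w)))%N,
      node_atom w' = inst (node_env w) (nth atom0 (body (node_clause w)) (node_index w')) &
      node_rank w = (node_rank w').+1].

(** The base [y] is 1/2 at every world. *)
Definition half_exp (n : nat) : R := 2^-1 ^+ n.

Definition node_val w v : R :=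
  match v with
  | 0 => half_exp 1
  | 1 => half_exp (node_rank w).+1
  | 2 => half_exp c
  | 3 => (node_atom w == (p, c, 0%N, 0%N))%:R
  | 4 => half_exp (node_atom w).1.1.1
  | 5 => half_exp (node_atom w).1.1.2
  | 6 => half_exp (node_atom w).1.2
  | 7 => half_exp (node_atom w).2
  | v'.+4.+4 => if odd v' then (node_index w == v'./2)%:R else half_exp (node_env w v'./2)
  end.

Lemma half_exp_itv n : 0 <= half_exp n <= 1.
Proof.
by rewrite exprn_ge0 ?invr_ge0 //= exprn_ile1 ?invr_ge0 // invf_le1 // ler1n.
Qed.

Lemma node_val_itv w v : 0 <= node_val w v <= 1.
Proof.
have bool_itv (b : bool) : 0 <= (b%:R : R) <= 1 by case: b; rewrite ?lexx ?ler01.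
move: v; do 8![case; first by rewrite /node_val ?half_exp_itv ?bool_itv].
by move=> v /=; case: ifP; rewrite ?half_exp_itv ?bool_itv.
Qed.

Hypothesis node_inh : inhabited node.

Definition proof_model :=
  @KripkeModel R node node_inh node_acc node_val node_val_itv.
Local Notation M := proof_model.

Lemma eval_tform_node t (w : world M) : eval (tform t) w = half_exp (tval (node_env w) t).
Proof.
apply: eval_tform => i _.
by rewrite /= odd_double doubleK.
Qed.

Lemma node_fields a (w w' : world M) : node_atom w' = inst (node_env w) a ->
  forall q, q \in fields a -> eval (Var q.1) w' = eval q.2 w.
Proof.
move=> E q; rewrite !inE => /or4P[|||/orP[]] /eqP->.
- by [].
- by transitivity (half_exp (node_atom w').1.1.1) => //; rewrite E eval_TN.
- by transitivity (half_exp (node_atom w').1.1.2) => //; rewrite E eval_tform_node.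
- by transitivity (half_exp (node_atom w').1.2) => //; rewrite E eval_tform_node.
- by transitivity (half_exp (node_atom w').2) => //; rewrite E eval_tform_node.
Qed.

Lemma eval_child j (w : world M) : eval (child j) w = (node_index w == j)%:R.
Proof.
have E : eval (Var (kvar j)) w = (node_index w == j)%:R.
  by rewrite /= odd_double uphalf_double.
by rewrite /child eval_NegNeg E pnatr_eq0; case: (_ == j).
Qed.

(** A premise derivable with height [n.+1] comes from a clause instance whose body has height [n],
    and that instance is a node of rank [n]. At rank 0 no premise is derivable, so the body is
    empty. *)
Lemma node_child (w : world M) j : (j < size (body (node_clause w)))%N ->
  exists2 w' : world M, acc w w' & node_index w' = j.
Proof.
move=> jb; have := node_der w; case E : (node_rank w) => [|n] /holds_allP H.
  by case: (H _ (mem_nth atom0 jb)).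
have [C [s [CP bC EC]]] := H _ (mem_nth atom0 jb).
exists (Node j CP bC) => //; split=> //.
Qed.

(** Successors with another index contribute 1 to the infimum and 0 to the supremum; those with
    index [j] exist and all carry the prescribed value. *)
Lemma node_clause_form (w : world M) : eval (clause_form (node_clause w)) w = 1.
Proof.
apply/eval_And1; split; apply/eval_conj1 => f /mapP[].
  by move=> q qC ->; apply/eval_Iff1; exact: node_fields qC.
move=> j; rewrite mem_iota /= => jb -> {f}.
apply/eval_conj1 => f /mapP[q qa ->]{f}.
have F (w' : world M) : acc w w' -> node_index w' = j -> eval (Var q.1) w' = eval q.2 w.
  by move=> [_ E _] wj; apply: node_fields qa; rewrite E wj.
have [w' ww' wj] := node_child jb.
apply/eval_And1; split; apply/eval_Iff1; apply/eqP; rewrite eq_le; apply/andP; split.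
- apply: inf01_le; first by move=> _ [v _ <-]; exact: (eval_itv (Imp (child j) (Var q.1))).
  exists w' => //.
  change (pimp (eval (child j) w') (eval (Var q.1) w') = eval q.2 w).
  rewrite F // eval_child wj eqxx /pimp divr1; case: ifP => // H.
  by apply/eqP; rewrite eq_le H eval_le1.
- apply: le_inf01 => [|_ [v wv <-]]; first exact: eval_le1.
  change (eval q.2 w <= pimp (eval (child j) v) (eval (Var q.1) v)).
  rewrite eval_child; case: eqP => [vj|_]; last first.
    by rewrite /pimp mulr0n eval_ge0 eval_le1.
  by rewrite F // /pimp mulr1n divr1; case: ifP => // _; exact: eval_le1.
- apply: sup01_le => [|_ [v wv <-]]; first exact: eval_ge0.
  change (Num.min (eval (child j) v) (eval (Var q.1) v) <= eval q.2 w).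
  rewrite ge_min eval_child; case: eqP => [vj|_]; last by rewrite mulr0n eval_ge0.
  by rewrite F // lexx orbT.
- apply: le_sup01; first by move=> _ [v _ <-]; exact: (eval_itv (And (child j) (Var q.1))).
  exists w' => //.
  change (Num.min (eval (child j) w') (eval (Var q.1) w') = eval q.2 w).
  by rewrite F // eval_child wj eqxx; apply/min_idPr; exact: eval_le1.
Qed.

Lemma proof_model_program : satisfies M (program_form P p).
Proof.
move=> w; apply/eval_And1; split.
  apply/eval_disj1; exists (clause_form (node_clause w)).
    by apply: map_f; exact: node_clauseP.
  exact: node_clause_form.
apply/eval_And1; split.
  (* At each successor [vT] has value [half_exp (node_rank w)], so the bound is attained; without
     successors the infimum is 1. *)
  apply/eval_Imp1; rewrite /= /half_exp expr1 exprS ler_wpM2l ?invr_ge0 //.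
  apply: le_inf01 => [|_ [w' [_ _ ->] <-]] //.
  by have /andP[] := half_exp_itv (node_rank w).
apply/eval_And1; split=> //; apply/eval_Imp1.
rewrite eval_NegNeg.
have -> : eval (Var vG) w = (node_atom w == (p, c, 0%N, 0%N))%:R by [].
case: (node_atom w =P _) => E; last by rewrite mulr0n eqxx eval_ge0.
rewrite mulr1n oner_eq0 (_ : eval _ w = 1) ?lexx //.
apply/eval_conj1 => f; rewrite !inE => /or4P[] /eqP->; apply/eval_Iff1.
- by transitivity (half_exp (node_atom w).1.1.1) => //; rewrite E eval_TN.
- by transitivity (half_exp (node_atom w).1.1.2) => //; rewrite E.
- by transitivity (half_exp (node_atom w).1.2) => //; rewrite E.
- by transitivity (half_exp (node_atom w).2) => //; rewrite E.
Qed.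

Lemma proof_model_input : satisfies M (input_form c).
Proof. by move=> w; apply/eval_Iff1; rewrite eval_TN. Qed.

Lemma proof_model_goal (w : world M) : node_atom w = (p, c, 0%N, 0%N) ->
  eval goal_form w <> 1.
Proof.
move=> E; have y0 n : half_exp n != 0 by rewrite expf_neq0 // invr_eq0 pnatr_eq0.
move=> /eval_Or1[/eval_Or1[]|/eval_Or1[]].
- rewrite /= /half_exp expr1 => /eqP; rewrite invr_eq1 => /eqP/eqP.
  by rewrite (eqr_nat R 2 1).
- rewrite eval_Neg /= (negbTE (y0 _)) => /eqP; by rewrite eq_sym oner_eq0.
- rewrite eval_Neg /= (negbTE (y0 _)) => /eqP; by rewrite eq_sym oner_eq0.
- rewrite eval_Neg /= E eqxx oner_eq0 => /eqP; by rewrite eq_sym oner_eq0.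
Qed.

End ProofToModel.

(** The last step of a derivation of the goal is a world of the proof model refuting [goal_form];
    conversely, a refuting world of any model yields a derivation. *)
Lemma entails_unprovable (R : realType) P p c : all safe P ->
  entails R [set` [:: input_form c; program_form P p]] goal_form <->
  ~ proves P p c 0 0.
Proof.
move=> safeP; split=> [E [n]|nP M MG w].
  case: n => // n [C [s [CP bC EC]]].
  pose w : node P := Node 0 CP bC.
  apply: (@proof_model_goal R P p c (inhabits w) w EC).
  apply: E => g; rewrite /= !inE => /orP[]/eqP->.
    exact: proof_model_input.
  exact: proof_model_program.
apply: contrapT => phi1; apply: nP.
apply: (model_goal_proves safeP _ _ phi1); apply: MG; rewrite /= !inE eqxx ?orbT //.
Qed.

Lemma KPi_finite (R : realType) G f : finite_set G -> KPi R (G, f) <-> entails R G f.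
Proof.
move=> finG; split=> [[G0 [_ G0G] H] M MG|H]; last by exists G; first by split.
by apply: H => g /G0G; exact: MG.
Qed.

End Semantics.

(** * A base program and the recursive functions *)

Arguments CodeSeq.code : simpl never.
Local Notation code := CodeSeq.code.
Local Notation pNat t := (Atom 0 t (TN 0) (TN 0)).
Local Notation pCons := (Atom 1).
Local Notation pPair := (Atom 2).
Local Notation pNth := (Atom 3).
Local Notation pTag k ar := (Atom 4 k (TN ar) (TN 0)).
Local Notation pForm t := (Atom 5 t (TN 0) (TN 0)).
Local Notation pSubst := (Atom 6).
Local Notation pNum t u := (Atom 7 t u (TN 0)).

(** The list constructor on codes; the empty list has code 0, which is why [TN 0] ends lists in the
    clauses. *)
Definition code_cons a b := 2 ^ a * b.*2.+1.
Arguments code_cons : simpl never.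

Lemma codeE a s : code (a :: s) = code_cons a (code s).
Proof. by []. Qed.

Lemma code_inj : injective code.
Proof. exact: can_inj CodeSeq.codeK. Qed.

Lemma code_consP a b s : code_cons a b = code s -> exists2 t, s = a :: t & b = code t.
Proof.
move=> E; exists (CodeSeq.decode b); last by rewrite CodeSeq.decodeK.
by apply: code_inj; rewrite codeE CodeSeq.decodeK.
Qed.

(** [pNat] premises on variables serve safety. The first argument of [pSubst] codes the list of the
    formulas put for the variables, and connectives of equal arity share one clause through
    [pTag]. *)
Definition base : seq clause :=
 [:: Clause (pNat (TN 0)) [::];
  Clause (pNat (TS (TV 0))) [:: pNat (TV 0)];
  Clause (pCons (TN 0) (TV 0) (TS (TD (TV 0) (TV 0)))) [:: pNat (TV 0)];
  Clause (pCons (TS (TV 0)) (TV 1) (TD (TV 2) (TV 2)))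
    [:: pCons (TV 0) (TV 1) (TV 2)];
  Clause (pPair (TV 0) (TV 1) (TV 2))
    [:: pCons (TV 1) (TN 0) (TV 3); pCons (TV 0) (TV 3) (TV 2)];
  Clause (pNth (TV 2) (TN 0) (TV 0)) [:: pCons (TV 0) (TV 1) (TV 2)];
  Clause (pNth (TV 2) (TS (TV 3)) (TV 4))
    [:: pCons (TV 0) (TV 1) (TV 2); pNth (TV 1) (TV 3) (TV 4)];
  Clause (pTag (TN 1) 2) [::];
  Clause (pTag (TN 2) 2) [::];
  Clause (pTag (TN 3) 2) [::];
  Clause (pTag (TN 4) 2) [::];
  Clause (pTag (TN 5) 1) [::];
  Clause (pTag (TN 6) 0) [::];
  Clause (pTag (TN 7) 0) [::];
  Clause (pTag (TN 8) 1) [::];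
  Clause (pTag (TN 9) 1) [::];
  Clause (pForm (TV 0)) [:: pPair (TN 0) (TV 1) (TV 0)];
  Clause (pForm (TV 0)) [:: pTag (TV 1) 0; pCons (TV 1) (TN 0) (TV 0)];
  Clause (pForm (TV 0))
    [:: pTag (TV 1) 1; pForm (TV 2); pPair (TV 1) (TV 2) (TV 0)];
  Clause (pForm (TV 0))
    [:: pTag (TV 1) 2; pForm (TV 2); pForm (TV 3); pPair (TV 2) (TV 3) (TV 4);
        pCons (TV 1) (TV 4) (TV 0)];
  Clause (pSubst (TV 0) (TV 1) (TV 2))
    [:: pPair (TN 0) (TV 3) (TV 1); pNth (TV 0) (TV 3) (TV 2); pForm (TV 2)];
  Clause (pSubst (TV 0) (TV 1) (TV 1))
    [:: pNat (TV 0); pTag (TV 2) 0; pCons (TV 2) (TN 0) (TV 1)];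
  Clause (pSubst (TV 0) (TV 1) (TV 2))
    [:: pTag (TV 3) 1; pPair (TV 3) (TV 4) (TV 1);
        pSubst (TV 0) (TV 4) (TV 5); pPair (TV 3) (TV 5) (TV 2)];
  Clause (pSubst (TV 0) (TV 1) (TV 2))
    [:: pTag (TV 3) 2; pPair (TV 4) (TV 5) (TV 6); pCons (TV 3) (TV 6) (TV 1);
        pSubst (TV 0) (TV 4) (TV 7); pSubst (TV 0) (TV 5) (TV 8);
        pPair (TV 7) (TV 8) (TV 9); pCons (TV 3) (TV 9) (TV 2)];
  Clause (pNum (TN 0) (TN (code_form Top))) [::];
  Clause (pNum (TS (TV 0)) (TV 1))
    [:: pNum (TV 0) (TV 2); pPair (TN (code_form (Var vY))) (TV 2) (TV 3);
        pCons (TN 3) (TV 3) (TV 1)]].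

Definition form_of n : form := xget Bot [set f | code_form f = n].

Lemma code_formK : cancel code_form form_of.
Proof.
move=> f; apply: code_form_inj; rewrite /form_of.
by case: xgetP => [g _ gf|/(_ f)/(_ erefl)].
Qed.

(** Total by default: a number that codes no formula is read as [Bot]. The variable clause of
    [pSubst] demands a position inside the list and a formula code there. *)
Definition subst_of s i := form_of (nth 0 (CodeSeq.decode s) i).

(** Only upper bounds are recorded. A tag stands for an operation that commutes with substitution
    and can be recovered from codes, so each arity is treated uniformly. *)
Definition base_interp : interp := fun l a b c =>
  match l with
  | 1 => c = code_cons a b
  | 2 => c = code [:: a; b]
  | 3 => forall s, a = code s -> b < size s /\ c = nth 0 s b
  | 4 => match b with
    | 0 => exists2 f, code_form f = code [:: a] & forall s, subst s f = f
    | 1 => exists op : form -> form,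
      [/\ forall f, code_form (op f) = code [:: a; code_form f],
          forall s f, subst s (op f) = op (subst s f) &
          forall f b, code_form f = code [:: a; b] -> exists g, f = op g]
    | 2 => exists op : form -> form -> form,
      [/\ forall f g, code_form (op f g) = code [:: a; code_form f; code_form g],
          forall s f g, subst s (op f g) = op (subst s f) (subst s g) &
          forall f b c, code_form f = code [:: a; b; c] -> exists g h, f = op g h]
    | _ => True end
  | 5 => exists f, a = code_form f
  | 6 => forall f, b = code_form f -> c = code_form (subst (subst_of a) f)
  | 7 => b = code_form (numeral a)
  | _ => True
  end.

Lemma base_sound : sound base base_interp.
Proof.
have inv1 (op : form -> form) k : (forall f, code_form (op f) = code [:: k; code_form f]) ->
    (forall s f, subst s (op f) = op (subst s f)) ->
    (forall f b, code_form f = code [:: k; b] -> exists g, f = op g) ->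
    base_interp 4 k 1 0 by exists op.
have inv2 (op : form -> form -> form) k :
    (forall f g, code_form (op f g) = code [:: k; code_form f; code_form g]) ->
    (forall s f g, subst s (op f g) = op (subst s f) (subst s g)) ->
    (forall f b c, code_form f = code [:: k; b; c] -> exists g h, f = op g h) ->
    base_interp 4 k 2 0 by exists op.
repeat apply: sound_cons; last (by []); move=> s; rewrite /= /holds /=.
- by [].
- by [].
- by move=> _ /=; rewrite /code_cons expn0 mul1n -addnn.
- case=> -> _; rewrite /code_cons expnS -mulnA mul2n addnn //.
- by move=> [/= -> [-> _]].
- by move=> [-> _] t /code_consP[t' -> _].
- by move=> [-> [IH _]] t /code_consP[t' -> /IH].
- by move=> _; apply: (inv2 And) => // -[]// > /code_inj[] // *; eexists; eexists.
- by move=> _; apply: (inv2 Or) => // -[]// > /code_inj[] // *; eexists; eexists.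
- by move=> _; apply: (inv2 Prod) => // -[]// > /code_inj[] // *; eexists; eexists.
- by move=> _; apply: (inv2 Imp) => // -[]// > /code_inj[] // *; eexists; eexists.
- by move=> _; apply: (inv1 Neg) => // -[]// > /code_inj[] // *; eexists.
- by exists Bot.
- by exists Top.
- by move=> _; apply: (inv1 Box) => // -[]// > /code_inj[] // *; eexists.
- by move=> _; apply: (inv1 Dia) => // -[]// > /code_inj[] // *; eexists.
- by move=> [/= -> _]; exists (Var (s 1)).
- by move=> [/= [f fE _] [-> _]]; exists f; rewrite fE.
- move=> [/= [op [opE _ _]] [[f ->] [-> _]]]; by exists (op f); rewrite opE.
- move=> [/= [op [opE _ _]] [[f ->] [[g ->] [E [-> _]]]]].
  by exists (op f g); rewrite opE E.
- move=> [/= E [nE [[f fE] _]]] g; rewrite E.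
  case: g => // > /code_inj[] // <- /=; rewrite /subst_of.
  have [_ <-] := nE (CodeSeq.decode (s 0)) (esym (CodeSeq.decodeK _)).
  by rewrite fE code_formK.
- move=> [/= _ [[f fE fS] [E _]]] g; rewrite E -[code_cons _ _]/(code [:: s 2]) -fE.
  by move=> /code_form_inj <-; rewrite fS.
- move=> [/= [op [opE opS opI]] [E1 [IH [E2 _]]]] f.
  rewrite E1 => /esym/[dup] /opI[g ->]; rewrite opE opS opE => /code_inj[/esym/IH <-].
  by rewrite E2.
- move=> [/= [op [opE opS opI]] [E1 [E2 [IH1 [IH2 [E3 [E4 _]]]]]]] f.
  rewrite E2 E1 -codeE => /esym/[dup] /opI[g [h ->]].
  rewrite opE opS opE => /code_inj[/esym/IH1 <- /esym/IH2 <-].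
  by rewrite E4 E3 -codeE.
- by [].
- by move=> [/= -> [-> [-> _]]].
Qed.

Definition clause0 := Clause atom0 [::].

Lemma proves_nth P Q i s : i < size Q ->
  holds_all (proves (P ++ Q)) s (body (nth clause0 Q i)) ->
  holds (proves (P ++ Q)) s (head (nth clause0 Q i)).
Proof. by move=> iQ; apply: proves_clause; rewrite mem_cat mem_nth ?orbT. Qed.

(** Applies clause [i] of [Q]; [vs] lists the values of the clause variables in order. *)
Ltac by_clause P Q i vs :=
  let pf := fresh "pf" in
  have pf := @proves_nth P Q i (nth 0 vs) isT;
  rewrite /= /holds /= in pf; apply: pf.

Ltac by_base i vs := by_clause (@nil clause) base i vs.

Lemma base_nat a : proves base 0 a 0 0.
Proof.
elim: a => [|a IH]; first by by_base 0 (@nil nat).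
by by_base 1 [:: a].
Qed.

Lemma base_cons a b c : proves base 1 a b c <-> c = code_cons a b.
Proof.
split=> [/(proves_sound base_sound)//|->].
elim: a => [|a IH].
  rewrite /code_cons expn0 mul1n -addnn.
  by by_base 2 [:: b]; split=> //; exact: base_nat.
rewrite /code_cons expnS -mulnA mul2n -addnn.
by by_base 3 [:: a; b; code_cons a b].
Qed.

Lemma base_pair a b c : proves base 2 a b c <-> c = code [:: a; b].
Proof.
split=> [/(proves_sound base_sound)//|->].
by by_base 4 [:: a; b; code [:: a; b]; code [:: b]]; rewrite !base_cons.
Qed.

Lemma base_nth s i : i < size s -> proves base 3 (code s) i (nth 0 s i).
Proof.
elim: s i => [|a s IH] [|i] //= si.
  by by_base 5 [:: a; code s; code (a :: s)]; rewrite base_cons.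
by_base 6 [:: a; code s; code (a :: s); i; nth 0 s i].
by rewrite base_cons; do 2?split => //; exact: IH.
Qed.

Lemma base_tag k r :
  (k, r) \in [:: (1, 2); (2, 2); (3, 2); (4, 2); (5, 1); (6, 0); (7, 0); (8, 1); (9, 1)] ->
  proves base 4 k r 0.
Proof.
rewrite !inE.
case/predU1P=> [[-> ->]|]; first by by_base 7 (@nil nat).
case/predU1P=> [[-> ->]|]; first by by_base 8 (@nil nat).
case/predU1P=> [[-> ->]|]; first by by_base 9 (@nil nat).
case/predU1P=> [[-> ->]|]; first by by_base 10 (@nil nat).
case/predU1P=> [[-> ->]|]; first by by_base 11 (@nil nat).
case/predU1P=> [[-> ->]|]; first by by_base 12 (@nil nat).
case/predU1P=> [[-> ->]|]; first by by_base 13 (@nil nat).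
case/predU1P=> [[-> ->]|]; first by by_base 14 (@nil nat).
by move=> /eqP[-> ->]; by_base 15 (@nil nat).
Qed.

Lemma base_form f : proves base 5 (code_form f) 0 0.
Proof.
have nullary k : proves base 4 k 0 0 -> proves base 5 (code [:: k]) 0 0.
  by move=> kP; by_base 17 [:: code [:: k]; k]; rewrite base_cons.
have unary k a : proves base 4 k 1 0 -> proves base 5 a 0 0 ->
    proves base 5 (code [:: k; a]) 0 0.
  by move=> kP aP; by_base 18 [:: code [:: k; a]; k; a]; rewrite base_pair.
have binary k a b : proves base 4 k 2 0 -> proves base 5 a 0 0 ->
    proves base 5 b 0 0 -> proves base 5 (code [:: k; a; b]) 0 0.
  move=> kP aP bP; by_base 19 [:: code [:: k; a; b]; k; a; b; code [:: a; b]].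
  by rewrite base_pair base_cons.
elim: f => [p|f IHf g IHg|f IHf g IHg|f IHf g IHg|f IHf g IHg|f IHf|||f IHf|f IHf] /=;
  try by [apply: binary => //; exact: base_tag | apply: unary => //; exact: base_tag |
          apply: nullary; exact: base_tag].
by by_base 16 [:: code [:: 0; p]; p]; rewrite base_pair.
Qed.

Fixpoint var_bound f :=
  match f with
  | Var p => p.+1
  | And f g | Or f g | Prod f g | Imp f g => maxn (var_bound f) (var_bound g)
  | Neg f | Box f | Dia f => var_bound f
  | Bot | Top => 0
  end.

(** A finite list covering the variables of [f] suffices, so a substitution can enter a Horn
    derivation as a single number. *)
Lemma base_subst S f : var_bound f <= size S ->
  proves base 6 (code (map code_form S)) (code_form f) (code_form (subst (nth Bot S) f)).
Proof.
set s := code _.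
have nullary k : proves base 4 k 0 0 -> proves base 6 s (code [:: k]) (code [:: k]).
  move=> kP; by_base 21 [:: s; code [:: k]; k]; rewrite base_cons.
  by split=> //; exact: base_nat.
have unary k a b : proves base 4 k 1 0 -> proves base 6 s a b ->
    proves base 6 s (code [:: k; a]) (code [:: k; b]).
  move=> kP aP; by_base 22 [:: s; code [:: k; a]; code [:: k; b]; k; a; b].
  by rewrite !base_pair.
have binary k a a' b b' : proves base 4 k 2 0 -> proves base 6 s a a' ->
    proves base 6 s b b' -> proves base 6 s (code [:: k; a; b]) (code [:: k; a'; b']).
  move=> kP aP bP.
  by_base 23 [:: s; code [:: k; a; b]; code [:: k; a'; b']; k; a; b; code [:: a; b];
                 a'; b'; code [:: a'; b']].
  by rewrite !base_pair !base_cons.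
elim: f => [p|f IHf g IHg|f IHf g IHg|f IHf g IHg|f IHf g IHg|f IHf|||f IHf|f IHf] /=;
  rewrite ?geq_max; try case/andP;
  try by [move=> *; apply: binary; auto; exact: base_tag |
          move=> *; apply: unary; auto; exact: base_tag |
          move=> *; apply: nullary; exact: base_tag].
move=> pS; by_base 20 [:: s; code [:: 0; p]; code_form (nth Bot S p); p].
rewrite base_pair; split=> //; split; last by split=> //; exact: base_form.
by rewrite -(nth_map Bot 0) //; apply: base_nth; rewrite size_map.
Qed.

Lemma base_num a : proves base 7 a (code_form (numeral a)) 0.
Proof.
elim: a => [|a IH]; first by by_base 24 (@nil nat).
by_base 25 [:: a; code_form (numeral a.+1); code_form (numeral a);
                code [:: code_form (Var vY); code_form (numeral a)]].
by rewrite base_pair base_cons.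
Qed.

(** * Horn definability of the recursive functions *)

Definition extends_base n P := extends 8 base n P.

Lemma base_extends : extends_base 8 base.
Proof. exact: extends_refl. Qed.

Section BaseFacts.
Variables (n : nat) (P : seq clause).
Hypothesis bP : extends_base n P.

Lemma base_le l : l < 8 -> l < n.
Proof. by case: bP => le _ _ _ lt; exact: leq_trans lt le. Qed.

Lemma base_eq l : l < 8 -> proves P l = proves base l.
Proof. by case: bP => _ _ _; apply. Qed.

Lemma ext_base J l : l < 8 -> ext_interp P n J l = proves base l.
Proof. by move=> l8; rewrite ext_old ?base_eq ?base_le. Qed.

Lemma extends_add k Q : labelled (n + k) Q -> all safe Q ->
  all (fun C => n <= lab (head C)) Q -> extends n P (n + k) (P ++ Q).
Proof. by case: bP => _ wP sP _; exact: extends_cat. Qed.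

Lemma extends_sound Q J l a b c : sound Q (ext_interp P n J) ->
  proves (P ++ Q) (n + l) a b c -> J l a b c.
Proof. by case: bP => _ wP _ _ S /(ext_sound wP S); rewrite ext_new. Qed.

End BaseFacts.

Lemma extends_base_trans n P n' P' :
  extends_base n P -> extends n P n' P' -> extends_base n' P'.
Proof. exact: extends_trans. Qed.

Definition computes P l k (f : k.-tuple nat -> nat) :=
  forall (x : k.-tuple nat) y, proves P l (code x) y 0 <-> y = f x.

(** Quantifying over all extensions of [base] allows the programs for several functions to be
    stacked, each with fresh labels. *)
Definition definable k (f : k.-tuple nat -> nat) :=
  forall n P, extends_base n P -> exists n' P' l,
    [/\ extends n P n' P', l < n' & computes P' l f].

Lemma computes_extends n P n' P' l k (f : k.-tuple nat -> nat) :
  extends n P n' P' -> l < n -> computes P l f -> computes P' l f.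
Proof. by move=> [_ _ _ E] ln cf x y; rewrite E. Qed.

Ltac extend bP :=
  apply: extends_add; rewrite //=; case: (bP) => *; lia.

Ltac sound_clause := apply: sound_cons => [s|]; first rewrite /= /holds /=.

Lemma computes_new n P Q J j k (f : k.-tuple nat -> nat) : extends_base n P ->
  sound Q (ext_interp P n J) ->
  (forall (x : k.-tuple nat) y, J j (code x) y 0 -> y = f x) ->
  (forall x : k.-tuple nat, proves (P ++ Q) (n + j) (code x) (f x) 0) ->
  computes (P ++ Q) (n + j) f.
Proof.
move=> bP S JE H x y; split=> [|->]; last exact: H.
by move=> /(extends_sound bP S)/JE.
Qed.

(** Constrains only codes of [k]-tuples, the inputs on which [computes] is tested. *)
Definition graph k (f : k.-tuple nat -> nat) a b :=
  forall x : k.-tuple nat, a = code x -> b = f x.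

Lemma definable_zero k : definable (fun _ : k.-tuple nat => 0).
Proof.
move=> n P bP; pose Q := [:: Clause (Atom (n + 0) (TV 0) (TN 0) (TN 0)) [:: pNat (TV 0)]].
have E : extends n P (n + 1) (P ++ Q) by extend bP.
have bPQ := extends_base_trans bP E.
exists (n + 1), (P ++ Q), (n + 0); split=> //; first by rewrite ltn_add2l.
apply: (computes_new (J := fun _ _ b _ => b = 0)) => //.
  by sound_clause => //; rewrite ext_new.
move=> x; by_clause P Q 0 [:: code x : nat].
by rewrite (base_eq bPQ) //; split=> //; exact: base_nat.
Qed.

Lemma definable_succ : @definable 1 (fun x => (tnth x ord0).+1).
Proof.
set f := fun x => _.
move=> n P bP; pose Q := [:: Clause (Atom (n + 0) (TV 0) (TS (TV 1)) (TN 0))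
                             [:: pCons (TV 1) (TN 0) (TV 0)]].
have E : extends n P (n + 1) (P ++ Q) by extend bP.
have bPQ := extends_base_trans bP E.
exists (n + 1), (P ++ Q), (n + 0); split=> //; first by rewrite ltn_add2l.
apply: (computes_new (J := fun _ a b _ => graph f a b)) => //.
- sound_clause => //; rewrite ext_new !(ext_base bP) // base_cons => -[-> _] x.
  by rewrite /f; case/tupleP: x => a' x /code_consP[t [-> _] _]; rewrite tnth0.
- by move=> x y; exact.
move=> x; by_clause P Q 0 [:: code x : nat; tnth x ord0]; rewrite (base_eq bPQ) //; split=> //.
by rewrite base_cons; case/tupleP: x => a x; rewrite (tuple0 x) tnth0.
Qed.

Lemma definable_proj k (i : 'I_k) : definable (fun x : k.-tuple nat => tnth x i).
Proof.
set f := fun x => _.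
move=> n P bP; pose Q := [:: Clause (Atom (n + 0) (TV 0) (TV 1) (TN 0))
                             [:: pNth (TV 0) (TN i) (TV 1)]].
have E : extends n P (n + 1) (P ++ Q) by extend bP.
have bPQ := extends_base_trans bP E.
exists (n + 1), (P ++ Q), (n + 0); split=> //; first by rewrite ltn_add2l.
apply: (computes_new (J := fun _ a b _ => graph f a b)) => //.
- sound_clause => //; rewrite ext_new !(ext_base bP) // => -[+ _] x E0.
  by rewrite /f (tnth_nth 0) => /(proves_sound base_sound)/(_ x E0)[].
- by move=> x y; exact.
move=> x; by_clause P Q 0 [:: code x : nat; f x]; rewrite (base_eq bPQ) //; split=> //.
by rewrite /f (tnth_nth 0); apply: base_nth; rewrite size_tuple.
Qed.

Lemma definable_seq k m (g : 'I_m -> k.-tuple nat -> nat) (r : seq 'I_m) :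
  (forall i, definable (g i)) ->
  definable (fun x => code [seq g i x | i <- r]).
Proof.
move=> dg; elim: r => [|i r IH]; first exact: definable_zero.
set f := fun x => _.
move=> n0 P0 bP0; have [n1 [P1 [l1 [E1 ln1 c1]]]] := IH _ _ bP0.
have bP1 := extends_base_trans bP0 E1.
have [n [P [l2 [E2 ln2 c2]]]] := dg i _ _ bP1.
have bP := extends_base_trans bP1 E2.
have l1n : l1 < n by case: E2 => le _ _ _; exact: leq_trans le.
have {}c1 := computes_extends E2 ln1 c1.
pose Q := [:: Clause (Atom (n + 0) (TV 0) (TV 3) (TN 0))
   [:: Atom l1 (TV 0) (TV 2) (TN 0); Atom l2 (TV 0) (TV 1) (TN 0);
       pCons (TV 1) (TV 2) (TV 3)]].
have E : extends n P (n + 1) (P ++ Q) by extend bP.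
have bPQ := extends_base_trans bP E.
have {}E0 := extends_trans E1 (extends_trans E2 E).
exists (n + 1), (P ++ Q), (n + 0); split=> //; first by rewrite ltn_add2l.
apply: (computes_new (J := fun _ a b _ => graph f a b)) => //.
- sound_clause => //; rewrite ext_new (ext_old P _ l1n) (ext_old P _ ln2).
  rewrite (ext_base bP _ (isT : 1 < 8)) base_cons.
  by move=> [H1 [H2 [-> _]]] x Ex; move: H1 H2; rewrite Ex c1 c2 => -> ->.
- by move=> x y; exact.
move=> x; by_clause P Q 0 [:: code x : nat; g i x; code [seq g i x | i <- r]; f x].
rewrite (base_eq bPQ (isT : 1 < 8)) base_cons.
by rewrite (computes_extends E l1n c1) (computes_extends E ln2 c2).
Qed.

Lemma definable_comp k m (f : m.-tuple nat -> nat) (g : 'I_m -> k.-tuple nat -> nat) :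
  definable f -> (forall i, definable (g i)) ->
  definable (fun x => f [tuple g i x | i < m]).
Proof.
move=> df dg; set h := fun x => _.
move=> n0 P0 bP0; have [n1 [P1 [l1 [E1 ln1 c1]]]] := definable_seq (enum 'I_m) dg bP0.
have bP1 := extends_base_trans bP0 E1.
have [n [P [l2 [E2 ln2 c2]]]] := df _ _ bP1.
have bP := extends_base_trans bP1 E2.
have l1n : l1 < n by case: E2 => le _ _ _; exact: leq_trans le.
have {}c1 := computes_extends E2 ln1 c1.
pose Q := [:: Clause (Atom (n + 0) (TV 0) (TV 2) (TN 0))
   [:: Atom l1 (TV 0) (TV 1) (TN 0); Atom l2 (TV 1) (TV 2) (TN 0)]].
have E : extends n P (n + 1) (P ++ Q) by extend bP.
have bPQ := extends_base_trans bP E.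
have {}E0 := extends_trans E1 (extends_trans E2 E).
exists (n + 1), (P ++ Q), (n + 0); split=> //; first by rewrite ltn_add2l.
have gE x : [seq g i x | i <- enum 'I_m] = [tuple g i x | i < m].
  by [].
apply: (computes_new (J := fun _ a b _ => graph h a b)) => //.
- sound_clause => //; rewrite ext_new (ext_old P _ l1n) (ext_old P _ ln2).
  by move=> [H1 [H2 _]] x Ex; move: H1 H2; rewrite Ex c1 => ->; rewrite gE c2.
- by move=> x y; exact.
move=> x; by_clause P Q 0 [:: code x : nat; code [seq g i x | i <- enum 'I_m]; h x].
rewrite (computes_extends E l1n c1); split=> //; split=> //.
by rewrite gE (computes_extends E ln2 c2).
Qed.

Lemma definable_prim k (f : k.-tuple nat -> nat) (g : k.+2.-tuple nat -> nat)
    (h : k.+1.-tuple nat -> nat) :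
  definable f -> definable g ->
  (forall x : k.-tuple nat, h [tuple of 0%N :: x] = f x) ->
  (forall n (x : k.-tuple nat),
       h [tuple of n.+1 :: x] = g [tuple of n :: h [tuple of n :: x] :: x]) ->
  definable h.
Proof.
move=> df dg h0 hS.
move=> n0 P0 bP0; have [n1 [P1 [l1 [E1 ln1 c1]]]] := df _ _ bP0.
have bP1 := extends_base_trans bP0 E1.
have [n [P [l2 [E2 ln2 c2]]]] := dg _ _ bP1.
have bP := extends_base_trans bP1 E2.
have l1n : l1 < n by case: E2 => le _ _ _; exact: leq_trans le.
have {}c1 := computes_extends E2 ln1 c1.
pose Q := [:: Clause (Atom (n + 0) (TV 0) (TV 1) (TN 0))
     [:: pCons (TN 0) (TV 2) (TV 0); Atom l1 (TV 2) (TV 1) (TN 0)];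
   Clause (Atom (n + 0) (TV 0) (TV 1) (TN 0))
     [:: pCons (TS (TV 2)) (TV 3) (TV 0); pCons (TV 2) (TV 3) (TV 4);
         Atom (n + 0) (TV 4) (TV 5) (TN 0);
         pCons (TV 5) (TV 3) (TV 6); pCons (TV 2) (TV 6) (TV 7);
         Atom l2 (TV 7) (TV 1) (TN 0)]].
have E : extends n P (n + 1) (P ++ Q) by extend bP.
have bPQ := extends_base_trans bP E.
have {}E0 := extends_trans E1 (extends_trans E2 E).
exists (n + 1), (P ++ Q), (n + 0); split=> //; first by rewrite ltn_add2l.
apply: (computes_new (J := fun _ a b _ => graph h a b)) => //.
- do 2?[sound_clause => //]; rewrite !ext_new ?(ext_old P _ l1n) ?(ext_old P _ ln2)
    !(ext_base bP _ (isT : 1 < 8)) ?base_cons.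
    move=> [-> [H _]] x; case/tupleP: x => i x /= /code_consP[_ [-> <-] Ex].
    by move: H; rewrite Ex c1 h0.
  move=> [-> [-> [H1 [-> [-> [H2 _]]]]]] x; case/tupleP: x => i x /=.
  move=> /code_consP[_ [-> <-] Ex]; rewrite hS.
  have := H1 [tuple of s 2 :: x]; rewrite /= codeE Ex => /(_ erefl) E5.
  by have := c2 [tuple of s 2 :: h [tuple of s 2 :: x] :: x] (s 1);
    rewrite /= !codeE -E5 -Ex => -[/(_ H2)].
- by move=> x y; exact.
move=> x; case/tupleP: x => i x; elim: i => [|i IH].
  rewrite h0; by_clause P Q 0 [:: code (0 :: x); f x; code x].
  by rewrite (base_eq bPQ (isT : 1 < 8)) base_cons (computes_extends E l1n c1).
rewrite hS; set y := [tuple of i :: _ :: _].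
by_clause P Q 1 [:: code (i.+1 :: x); g y; i; code x; code (i :: x);
   h [tuple of i :: x]; code (h [tuple of i :: x] :: x); code y].
rewrite (base_eq bPQ (isT : 1 < 8)) !base_cons; do 5!split=> //.
by rewrite (computes_extends E ln2 c2).
Qed.

(** Horn clauses have no negation: a nonzero value of [f] is expressed as a successor, and an
    auxiliary predicate counts upwards while all values of [f] so far are successors. *)
Lemma definable_min k (f : k.+1.-tuple nat -> nat) (h : k.-tuple nat -> nat) :
  definable f -> 
  (forall x : k.-tuple nat, f [tuple of h x :: x] = 0%N) ->
  (forall (x : k.-tuple nat) n, (n < h x)%N -> f [tuple of n :: x] <> 0%N) ->
  definable h.
Proof.
move=> df f0 fS.
move=> n0 P0 bP0; have [n [P [l1 [E1 ln1 c1]]]] := df _ _ bP0.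
have bP := extends_base_trans bP0 E1.
pose Q := [:: Clause (Atom (n + 0) (TN 0) (TV 0) (TN 0)) [:: pNat (TV 0)];
   Clause (Atom (n + 0) (TS (TV 0)) (TV 1) (TN 0))
     [:: Atom (n + 0) (TV 0) (TV 1) (TN 0);
         pCons (TV 0) (TV 1) (TV 2); pNat (TV 3); Atom l1 (TV 2) (TS (TV 3)) (TN 0)];
   Clause (Atom (n + 1) (TV 0) (TV 1) (TN 0))
     [:: Atom (n + 0) (TV 1) (TV 0) (TN 0);
         pCons (TV 1) (TV 0) (TV 2); Atom l1 (TV 2) (TN 0) (TN 0)]].
have E : extends n P (n + 2) (P ++ Q) by extend bP.
have bPQ := extends_base_trans bP E.
have {}E0 := extends_trans E1 E.
exists (n + 2), (P ++ Q), (n + 1); split=> //; first by rewrite ltn_add2l.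
pose J (l a b c : nat) := if l is 0 then
  forall x : k.-tuple nat, b = code x -> forall i, i < a -> f [tuple of i :: x] <> 0
  else graph h a b.
apply: (computes_new (J := J)) => //.
- do 3?[sound_clause => //]; rewrite ?ext_new ?(ext_old P _ ln1)
    ?(ext_base bP _ (isT : 1 < 8)) ?(ext_base bP _ (isT : 0 < 8)) ?base_cons //.
    move=> [IH [Ex [_ [H _]]]] x E2 i; rewrite ltnS leq_eqVlt => /predU1P[->|]; last exact: IH.
    have := c1 [tuple of s 0 :: x] (s 3).+1; rewrite /= codeE -E2 -Ex => -[/(_ H) <-] //.
  move=> [IH [Ex [H _]]] x E2.
  have := c1 [tuple of s 1 :: x] 0; rewrite /= codeE -E2 -Ex => -[/(_ H) H0 _].
  case: (ltngtP (s 1) (h x)) => // [/fS|/(IH _ E2)]; first by rewrite -H0.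
  by rewrite f0.
- by move=> x y; exact.
move=> x; have chk i : i <= h x -> proves (P ++ Q) (n + 0) i (code x) 0.
  elim: i => [|i IH] ih.
    by by_clause P Q 0 [:: code x : nat]; rewrite (base_eq bPQ) //; split=> //; exact: base_nat.
  by_clause P Q 1 [:: i; code x : nat; code (i :: x); (f [tuple of i :: x]).-1].
  rewrite (base_eq bPQ (isT : 0 < 8)) (base_eq bPQ (isT : 1 < 8)) base_cons.
  split; first exact: IH (ltnW ih).
  split=> //; split; first exact: base_nat.
  split=> //; apply/(computes_extends E ln1 c1 [tuple of i :: x]).
  by have := fS _ _ ih; case: (f _).
by_clause P Q 2 [:: code x : nat; h x; code (h x :: x)].
rewrite (base_eq bPQ (isT : 1 < 8)) base_cons; split; first exact: chk.
split=> //; split=> //; apply/(computes_extends E ln1 c1 [tuple of h x :: x]).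
by rewrite f0.
Qed.

Lemma recursive_definable k (f : k.-tuple nat -> nat) : recursive f -> definable f.
Proof.
elim=> {k f} [k||k i|k m f g _ df _ dg|k f g h _ df _ dg|k f h _ df].
- exact: definable_zero.
- exact: definable_succ.
- exact: definable_proj.
- exact: definable_comp.
- exact: definable_prim.
- exact: definable_min.
Qed.

(** * Derivability from a recursive set of rules *)

Local Open Scope classical_set_scope.

Lemma subst_comp s t f : subst s (subst t f) = subst (fun p => subst s (t p)) f.
Proof. by elim: f => //= [f -> g ->|f -> g ->|f -> g ->|f -> g ->|f ->|f ->|f ->]. Qed.

Lemma subst_Var f : subst Var f = f.
Proof. by elim: f => //= [f -> g ->|f -> g ->|f -> g ->|f -> g ->|f ->|f ->|f ->]. Qed.

Lemma eq_subst s t f : (forall p, p < var_bound f -> s p = t p) -> subst s f = subst t f.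
Proof.
elim: f => [p|f IHf g IHg|f IHf g IHg|f IHf g IHg|f IHf g IHg|f IHf|||f IHf|f IHf] //= H;
  rewrite ?H ?IHf ?IHg // => p pf; apply: H; rewrite // leq_max pf ?orbT //.
Qed.

(** A tree form of the least logic, with substitution instances of rules as steps and lists as
    premises, so that it can be traced by Horn clauses. *)
Inductive derives (A : set rule) (G : set form) : form -> Prop :=
| derives_hyp f : G f -> derives A G f
| derives_rule (H : seq form) h s : A ([set` H], h) ->
    (forall g, g \in H -> derives A G (subst s g)) -> derives A G (subst s h).

(** Cut grafts derivations onto hypotheses; a substitution applied to a derivation is composed with
    the one used at each step. *)
Lemma derives_logic A : is_logic [set r | derives A r.1 r.2].
Proof.
split=> [G f Gf|G D f GD /= Df|s G f /= Gf]; first exact: derives_hyp.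
  elim: Df => [g /GD//|H h s AH _ IH]; exact: derives_rule AH IH.
elim: Gf => [g Gg|H h t AH _ IH]; first by apply: derives_hyp; exists g.
rewrite subst_comp; apply: (derives_rule AH) => g gH.
by rewrite -subst_comp; exact: IH.
Qed.

Lemma smallest_derives A G f : A `<=` finitary ->
  smallest is_logic A (G, f) -> derives A G f.
Proof.
move=> finA sm; apply: (sm [set r | derives A r.1 r.2]).
split; first exact: derives_logic.
move=> [H h] AH /=; have /finite_seqP[s Hs] := finA _ AH; rewrite /= in Hs.
rewrite -[h]subst_Var; apply: (@derives_rule A _ s); first by rewrite -Hs.
by move=> g gs; rewrite subst_Var; apply: derives_hyp; rewrite Hs.
Qed.

Section Provability.
Variables (A : set rule).
Hypotheses (finA : A `<=` finitary) (recA : recursive_rules A).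
Local Notation L := (smallest is_logic A).
Local Notation codes G := (code (map code_form G)).

(* The predicates are: derivability of a formula from premises, derivability of
   all substituted premises of a rule, and the diagonal predicate. *)
Definition prov_clauses n l :=
  [:: Clause (Atom (n + 0) (TV 0) (TV 1) (TN 0)) [:: pNth (TV 0) (TV 2) (TV 1)];
  Clause (Atom (n + 0) (TV 0) (TV 1) (TN 0))
    [:: pCons (TV 2) (TV 3) (TV 4); pCons (TV 4) (TN 0) (TV 5);
        Atom l (TV 5) (TN 1) (TN 0); pSubst (TV 6) (TV 2) (TV 1);
        Atom (n + 1) (TV 0) (TV 6) (TV 3)];
  Clause (Atom (n + 1) (TV 0) (TV 1) (TN 0)) [:: pNat (TV 0); pNat (TV 1)];
  Clause (Atom (n + 1) (TV 0) (TV 1) (TV 2))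
    [:: pCons (TV 3) (TV 4) (TV 2); pSubst (TV 1) (TV 3) (TV 5);
        Atom (n + 0) (TV 0) (TV 5) (TN 0); Atom (n + 1) (TV 0) (TV 1) (TV 4)];
  Clause (Atom (n + 2) (TV 0) (TN 0) (TN 0))
    [:: pCons (TV 1) (TV 2) (TV 0); pNum (TV 0) (TV 3);
        pPair (TN (code_form (Var vX))) (TV 3) (TV 4); pCons (TN 4) (TV 4) (TV 5);
        pPair (TV 3) (TN (code_form (Var vX))) (TV 6); pCons (TN 4) (TV 6) (TV 7);
        pPair (TV 5) (TV 7) (TV 8); pCons (TN 1) (TV 8) (TV 9);
        pCons (TV 9) (TV 2) (TV 10); Atom (n + 0) (TV 10) (TV 1) (TN 0)]].

Definition prov_interp : interp := fun l a b c =>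
  match l with
  | 0 => forall G, a = codes G -> exists2 f, b = code_form f & L ([set` G], f)
  | 1 => forall G H, a = codes G -> c = codes H ->
         forall h, h \in H -> L ([set` G], subst (subst_of b) h)
  | _ => forall G f, a = code_rule G f -> L ([set` input_form a :: G], f)
  end.

(** Soundness is checked in [L] itself, which is closed under cut and substitution; completeness
    follows a tree of [derives]. The third predicate feeds a rule its own code as input. *)
Lemma provability_definable : exists P p, all safe P /\
  forall G f, proves P p (code_rule G f) 0 0 <->
    L ([set` input_form (code_rule G f) :: G], f).
Proof.
have [refL cutL subL] := smallest_logic A.
have [n [P [l [E0 ln cl]]]] := recursive_definable recA base_extends.
have bP : extends_base n P := E0.
pose Q := prov_clauses n l.
have E : extends n P (n + 3) (P ++ Q) by extend bP.
have bPQ := extends_base_trans bP E.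
exists (P ++ Q), (n + 2); split; first by case: E.
have SQ : sound Q (ext_interp P n prov_interp).
  do 5?[sound_clause => //]; rewrite !ext_new ?(ext_old P _ ln)
   ?(ext_base bP _ (isT : 1 < 8)) ?(ext_base bP _ (isT : 3 < 8)) ?(ext_base bP _ (isT : 6 < 8))
   ?(ext_base bP _ (isT : 2 < 8)) ?(ext_base bP _ (isT : 7 < 8)) ?base_cons ?base_pair /=.
  - move=> [/(proves_sound base_sound) H _] G /H[]; rewrite size_map => iG ->.
    exists (nth Bot G (s 2)); first by rewrite (nth_map Bot).
    by apply: refL; rewrite /= mem_nth.
  - move=> [E1 [E2 [E3 [/(proves_sound base_sound) E4 [E5 _]]]]] G EG.
    (* The characteristic function of [A] takes one-tuples, so [s 5] is the code of a list whose
       only entry is the rule code. *)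
    have := cl [tuple s 4] 1; rewrite /= codeE -E2 => -[/(_ E3) + _].
    rewrite tnth0; case: asboolP => // -[H [h [Er AH]]] _.
    move: E1 E4 E5; rewrite Er /code_rule => /esym/code_consP[_ [<- <-] ->] E4 E5.
    exists (subst (subst_of (s 6)) h); first exact: E4.
    apply: (cutL _ (subst (subst_of (s 6)) @` [set` H])).
      by move=> _ [g gH <-]; exact: E5 gH.
    by apply: subL => B [_]; exact.
  - by move=> _ G [|h H] _ /(@code_inj [::]).
  - move=> [-> [/(proves_sound base_sound) E2 [E3 [E4 _]]]] G H EG.
    case: H => [|h H] /code_consP[t]; first by [].
    case=> Eh <- EH g; rewrite inE => /predU1P[->|gH].
      have [f Ef Lf] := E3 G EG.
      by move: Ef; rewrite (E2 h) // => /code_form_inj ->.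
    exact: E4 gH.
  - move=> [E1 [/(proves_sound base_sound) /= E2 [E3 [E4 [E5 [E6 H]]]]]] G f Er.
    move: H => [E7 [E8 [E9 [E10 _]]]].
    move: E1 E10; rewrite Er /code_rule => /esym/code_consP[_ [<- <-] E11].
    move=> /(_ (input_form (code_rule G f) :: G)).
    have -> : s 10 = codes (input_form (code_rule G f) :: G).
      by rewrite E9 E11 /= codeE E8 E7 E6 E5 E4 E3 E2 Er.
    by move=> /(_ erefl)[g /code_form_inj ->].
move=> G f; split=> [/(extends_sound bP SQ)/(_ G f erefl)//|].
set G' := _ :: G; move=> /(smallest_derives finA) Df.
have D G0 g : derives A [set` G0] g -> proves (P ++ Q) (n + 0) (codes G0) (code_form g) 0.
  elim=> {g} [g /= gG|H h s AH _ IH].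
    by_clause P Q 0 [:: codes G0; code_form g; index g G0].
    rewrite (base_eq bPQ (isT : 3 < 8)); split=> //.
    rewrite -[in code_form g](nth_index Bot gG) -(nth_map Bot 0) ?index_mem //.
    by apply: base_nth; rewrite size_map index_mem.
  (* The rule has finitely many variables, so [s] may be replaced by the list of its first [m]
     values. *)
  pose m := \max_(g <- h :: H) var_bound g.
  pose S := map s (iota 0 m).
  have ES g : g \in h :: H ->
      proves (P ++ Q) 6 (codes S) (code_form g) (code_form (subst s g)).
    move=> gH; have gm : var_bound g <= m by exact: leq_bigmax_seq.
    rewrite (base_eq bPQ (isT : 6 < 8)) (@eq_subst s (nth Bot S)).
      by apply: base_subst; rewrite size_map size_iota.
    move=> p pg; have pm : p < m := leq_trans pg gm.
    by rewrite (nth_map 0) ?size_iota // nth_iota.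
  by_clause P Q 1 [:: codes G0; code_form (subst s h); code_form h; codes H;
                      code_rule H h; code [:: code_rule H h]; codes S].
  rewrite (base_eq bPQ (isT : 1 < 8)) !base_cons; split=> //; split=> //; split.
    apply/(computes_extends E ln cl [tuple code_rule H h]); rewrite tnth0.
    by case: asboolP => // -[]; exists H, h.
  split; first by apply: ES; rewrite inE eqxx.
  split=> //.
  have {ES} ES g : g \in H -> proves (P ++ Q) 6 (codes S) (code_form g) (code_form (subst s g)).
    by move=> gH; apply: ES; rewrite inE gH orbT.
  (* The code of the substitution is generalized because [S] was computed from the whole list on
     which the induction runs. *)
  clear AH; elim: H IH {m S} (codes S) ES => [|g H IHH] IH S' ES.
    by_clause P Q 2 [:: codes G0; S']; rewrite !(base_eq bPQ (isT : 0 < 8)).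
    by split; [exact: base_nat|split=> //; exact: base_nat].
  by_clause P Q 3 [:: codes G0; S'; codes (g :: H); code_form g; codes H;
                      code_form (subst s g)].
  rewrite (base_eq bPQ (isT : 1 < 8)) base_cons; split=> //.
  split; first by apply: ES; rewrite inE eqxx.
  split; first by apply: IH; rewrite inE eqxx.
  split=> //; apply: IHH => k kH; [apply: IH|apply: ES]; by rewrite inE kH orbT.
(* The witnesses assemble [input_form c] from its numeral outwards and put it in front of [G]. *)
set c := code_rule G f; set N := numeral c; set X := Var vX.
by_clause P Q 4 [:: c; code_form f; codes G; code_form N;
  code [:: code_form X; code_form N]; code_form (Imp X N);
  code [:: code_form N; code_form X]; code_form (Imp N X);
  code [:: code_form (Imp X N); code_form (Imp N X)]; code_form (input_form c);
  codes G'].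
rewrite (base_eq bPQ (isT : 1 < 8)) (base_eq bPQ (isT : 2 < 8)) (base_eq bPQ (isT : 7 < 8)).
rewrite !base_cons !base_pair; split=> //; split; first exact: base_num.
do 7![split; first by []]; split=> //; exact: D Df.
Qed.

End Provability.

Theorem corollary4p10 (R : realType) : ~ axiomatizable (KPi R).
Proof.
case=> A [finA recA LE].
have [P [p [safeP pP]]] := provability_definable finA recA.
(* The diagonal step: [P] and [p] are already fixed, and the rule coded by [c] does not mention [c],
   which enters only through the added input premise. *)
set G := [:: program_form P p]; set c := code_rule G goal_form.
have := pP G goal_form; rewrite -LE KPi_finite; last exact: finite_seq.
rewrite (entails_unprovable R p c safeP); tauto.
Qed.
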